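(* Let $u=(u^1,\dots,u^m):B_1^n(0)\to\mathbb{R}^m$ be a smooth solution to the minimal surface system satisfying the area-decreasing condition. Suppose further that $u^1\ge 0$ and $\|u^\beta\|_\infty<\epsilon$ for each $\beta=2,\dots,m$. Then there is an $\epsilon_0>0$ depending only on $m$, $n$ and $\|u\|_\infty$ such that $$|Du(0)|\le C_1e^{C_2\|u\|_\infty^2}\quad\text{provided }\epsilon\le\epsilon_0,$$ where $C_1$ depends on $n$, $m$ and $\|u\|_\infty$, and $C_2$ depends on $n$ and $m$.
   Context: $B_1^n(0)$ is the open unit ball of $\mathbb{R}^n$ and $\|\cdot\|_\infty=\|\cdot\|_{L^\infty(B_1^n(0))}$. A smooth $u$ solves the minimal surface system if, with $g_{ij}=\delta_{ij}+\sum_{\beta}\partial_iu^\beta\partial_ju^\beta$ and $(g^{ij})=(g_{ij})^{-1}$, one has $g^{ij}u^\beta_{ij}=0$ for each $\beta=1,\dots,m$ (equivalently, its graph is a minimal submanifold of $\mathbb{R}^{n+m}$). $u$ satisfies the area-decreasing condition if at every point the Jacobian of $Du:\mathbb{R}^n\to\mathbb{R}^m$ restricted to any two-dimensional subspace of $\mathbb{R}^n$ is at most $1$; equivalently, the singular values $\lambda_i$ of $Du$ satisfy $|\lambda_i\lambda_j|\le 1$ for $i\ne j$. *)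

(* Defs.v *)
From HB Require Import structures.
From mathcomp Require Import all_boot all_order all_algebra.
From mathcomp Require Import all_classical all_reals all_analysis.
Set Implicit Arguments.
Unset Strict Implicit.
Unset Printing Implicit Defensive.
Import Order.TTheory GRing.Theory Num.Theory.
Import numFieldNormedType.Exports.
Local Open Scope classical_set_scope.
Local Open Scope ring_scope.

(** Points of R^n are row vectors ['rV[R]_n].  The library norm [`| x |] on
    matrices is the max norm; it is used here only through the topology it
    induces, and Euclidean quantities are written with [enorm]. *)
Definition enorm {R : realType} {p q : nat} (A : 'M[R]_(p, q)) : R :=
  Num.sqrt (\sum_i \sum_j A i j ^+ 2).

Definition unit_ball (R : realType) (n : nat) : set 'rV[R]_n :=
  [set x | enorm x < 1].
Arguments unit_ball : clear implicits.

Definition component {R : realType} {n m : nat} (u : 'rV[R]_n -> 'rV[R]_m)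
    (b : 'I_m) : 'rV[R]_n -> R :=
  fun x => u x ord0 b.

Definition partial {R : realType} {n : nat} (i : 'I_n) (f : 'rV[R]_n -> R) :
    'rV[R]_n -> R :=
  fun x => 'D_(delta_mx ord0 i) f x.

Definition partials {R : realType} {n : nat} (s : seq 'I_n)
    (f : 'rV[R]_n -> R) : 'rV[R]_n -> R :=
  foldr partial f s.

(** Meaningful for open [D]: partial derivatives of all orders exist and are
    continuous at every point of [D]. *)
Definition smooth_on {R : realType} {n : nat} (D : set 'rV[R]_n)
    (f : 'rV[R]_n -> R) : Prop :=
  forall (s : seq 'I_n) (x : 'rV[R]_n), D x ->
    {for x, continuous (partials s f)} /\
    forall i : 'I_n, derivable (partials s f) x (delta_mx ord0 i).

(** n-dimensional Lebesgue measure zero: for every e > 0 there is a countable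
    cover by closed boxes of total volume at most e. *)
Definition lebesgue_null {R : realType} {n : nat} (A : set 'rV[R]_n) : Prop :=
  forall e : R, 0 < e ->
    exists a b : nat -> 'rV[R]_n,
      [/\ forall k i, a k ord0 i <= b k ord0 i,
          A `<=` \bigcup_k [set x | forall i,
                              a k ord0 i <= x ord0 i <= b k ord0 i]
        & (\sum_(0 <= k <oo) (\prod_i (b k ord0 i - a k ord0 i))%:E <= e%:E)%E].

(** The norm of L^oo(D); it is [+oo] when [f] is not essentially bounded. *)
Definition Linfty_norm {R : realType} {n : nat} (D : set 'rV[R]_n)
    (f : 'rV[R]_n -> R) : \bar R :=
  ereal_inf [set c%:E | c in
    [set c : R | 0 <= c /\ lebesgue_null (D `&` [set x | c < `|f x|])]].

Definition induced_metric {R : realType} {n m : nat}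
    (u : 'rV[R]_n -> 'rV[R]_m) (x : 'rV[R]_n) : 'M[R]_n :=
  \matrix_(i, j) ((i == j)%:R +
    \sum_(b < m) partial i (component u b) x * partial j (component u b) x).

Definition minimal_surface_system {R : realType} {n m : nat}
    (D : set 'rV[R]_n) (u : 'rV[R]_n -> 'rV[R]_m) : Prop :=
  forall x, D x -> forall b : 'I_m,
    \sum_i \sum_j invmx (induced_metric u x) i j *
                  partial j (partial i (component u b)) x = 0.

(** [L : 'M_(n, m)] acts on row vectors by [v |-> v *m L].  The rows of [V] are
    an orthonormal basis of a plane; the Jacobian of the restriction of [L] to
    that plane is the square root of the Gram determinant of the images of the
    basis vectors. *)
Definition plane_jacobian {R : realType} {n m : nat} (L : 'M[R]_(n, m))
    (V : 'M[R]_(2, n)) : R :=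
  Num.sqrt (\det ((V *m L) *m (V *m L)^T)).

Definition area_decreasing {R : realType} {n m : nat}
    (D : set 'rV[R]_n) (u : 'rV[R]_n -> 'rV[R]_m) : Prop :=
  forall x, D x -> forall V : 'M[R]_(2, n),
    V *m V^T = 1%:M -> plane_jacobian ('J u x) V <= 1.

(* Main.v *)
Require Import Defs.
From HB Require Import structures.
From mathcomp Require Import all_boot all_order all_algebra.
From mathcomp Require Import all_classical all_reals all_analysis.
From mathcomp Require Import perm measurable_realfun.
From mathcomp Require Import ring lra.
Import Order.TTheory GRing.Theory Num.Theory.
Import numFieldNormedType.Exports.
Local Open Scope classical_set_scope.
Local Open Scope ring_scope.

(** The proof is a Korevaar-type maximum principle for the largest singular
    value of the differential.  Write [g = 1 + Du Du^T] for the induced metric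
    (vectors are rows and [Du] acts on the right), and [Delta f = g^ij f_ij];
    because of the minimal surface system this is the Laplacian of the graph,
    and the components of [u] as well as the coordinates are harmonic for it.

    The first half is a differential inequality for
    [q (x) = 1 + max_(|e| = 1) |Du_x e|^2].  Suppose that
    [f ^ (N + 2) (1 + |Du e|^2)] is maximal at [(x, e)] among all points and all
    unit vectors.  Then [e] is an eigenvector of [Du Du^T]
    ([max_point_eigen]).  The second order condition is used along paths which
    move [x] with speed [v] and simultaneously rotate [e] with a speed [z]
    adapted to [v]; for the good choice of [z] the second derivatives of [u]
    enter through a form which is bounded below precisely when the product of
    the largest singular value with any other one is at most [1]
    ([key_ineq]).  Summing over vectors [v_k] with
    [\sum_k v_k^T v_k = g^-1] ([frameP]) turns the second derivatives in the
    directions [v_k] into [Delta], and the third derivatives of [u] are removed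
    by the derivative of the system in direction [e] ([mss_derivative]).  In
    effect [q] satisfies [Delta q >= 3 / 2 |grad q|^2 / q] in the barrier
    sense, and at the maximum this becomes
    [N / 2 |grad f|^2 + f Delta f <= 0] ([max_point_inequality]).

    The second half chooses
    [f = 3 / 4 - |x|^2 - a u^1 + c \sum_(b > 1) (u^b)^2] with [a] of order
    [1 / |u|] and [c] of order [n].  It is positive at the origin and, as
    [u^1 >= 0] and the other [u^b] are small, nonpositive near the boundary of
    the unit ball, so an interior maximum exists ([cutoff_energy_max]).  Suppose
    that the largest singular value is large there.  All other singular values
    are small, so the components of [u] have total energy close to [1] in the
    induced metric.  If a definite part of it belongs to the [u^b] with [b > 1],
    then [Delta f > 0].  If not, then [u^1] has most of it, and [|grad f|] is at
    least of order [a] because [grad u^1] is almost orthogonal to [grad |x|^2]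
    ([cross_bound]).  Either way the inequality above fails, in the second case
    because [N] is large ([large_gradient_absurd]).  Hence the largest singular
    value is bounded at the maximum point, and comparing the values at that
    point and at the origin gives the estimate.  The constant
    obtained depends on [n] and on the bound of [u], and the exponential factor
    only helps.

    The analysis behind this is elementary: continuously differentiable
    functions are differentiable, mixed derivatives commute, and a continuous
    function is bounded pointwise by its essential supremum, because a cube is
    not a null set ([box_volume_le]). *)

(** * Directional derivatives along segments *)

Lemma ler_coord_norm {R : realType} {n : nat} (v : 'rV[R]_n) i :
  `|v ord0 i| <= `|v|.
Proof.
rewrite [leRHS]/Num.Def.normr/= mx_normrE.
exact: (le_bigmax _ (fun ij : 'I_1 * 'I_n => `|v ij.1 ij.2|) (ord0, i)).
Qed.

Lemma rV_norm_le {R : realType} {n : nat} (v : 'rV[R]_n) (c : R) :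
  0 <= c -> (forall i, `|v ord0 i| <= c) -> `|v| <= c.
Proof.
move=> c0 vc; rewrite [leLHS]/Num.Def.normr/= mx_normrE.
by apply: bigmax_le => // -[i j] _; rewrite ord1.
Qed.

Lemma line_is_derive {R : realType} {n : nat} (f : 'rV[R]_n -> R)
    (x v : 'rV[R]_n) (t d : R) :
  is_derive (t *: v + x) v f d -> is_derive t 1 (fun s => f (s *: v + x)) d.
Proof.
move=> [df <-]; have E : (fun h => h^-1 *: (((fun s => f (s *: v + x)) \o shift t)
    (h *: 1) - f (t *: v + x))) =
  (fun h => h^-1 *: ((f \o shift (t *: v + x)) (h *: v) - f (t *: v + x))).
  by apply/funext => h /=; rewrite [_%:A]mulr1 scalerDl addrA.
by split; [rewrite /derivable E | rewrite /derive E].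
Qed.

Lemma is_derive_scalev {R : realType} {n : nat} (f : 'rV[R]_n -> R)
    (x v : 'rV[R]_n) (h d : R) :
  is_derive x v f d -> is_derive x (h *: v) f (h * d).
Proof.
move=> Df.
have D1 : is_derive (0 : R) 1 (fun s => f (s *: v + x)) d.
  by apply: line_is_derive; rewrite scale0r add0r.
have D2 : is_derive (0 : R) 1 (fun s => f (s *: (h *: v) + x)) (h * d).
  have -> : (fun s => f (s *: (h *: v) + x)) =
      (fun s => f (s *: v + x)) \o ( *%R^~ h).
    by apply/funext => s /=; rewrite scalerA.
  rewrite [X in is_derive _ _ _ X]mulrC; apply: is_derive1_comp.
    by rewrite mul0r.
  have -> : ( *%R^~ h) = h *: (id : R -> R).
    by apply/funext => s /=; rewrite mulrC.
  by apply: is_derive_eq; rewrite [_%:A]mulr1.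
have [dD2 D2E] := D2; split; first by apply/derivable1P.
by rewrite -D2E /derive; congr lim; apply: (congr1 (fun g => g @ 0^'));
  apply/funext => s /=; rewrite addr0 scale0r add0r [_%:A]mulr1.
Qed.

Lemma mvt_line {R : realType} {n : nat} (f : 'rV[R]_n -> R)
    (df : R -> R) (x v : 'rV[R]_n) :
  (forall t : R, 0 <= t <= 1 -> is_derive (t *: v + x) v f (df t)) ->
  exists2 t : R, 0 <= t <= 1 & f (v + x) - f x = df t.
Proof.
move=> Df.
have Df' (t : R) : 0 <= t <= 1 -> is_derive t 1 (fun s => f (s *: v + x)) (df t).
  by move=> t01; exact/line_is_derive/Df.
have [||t] := @MVT_segment R (fun s => f (s *: v + x)) df 0 1 ler01.
- by move=> t; rewrite in_itv/= => /andP[t0 t1]; apply: Df'; rewrite !ltW.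
- apply: derivable_within_continuous => t; rewrite in_itv/= => t01.
  by have [] := Df' _ t01.
rewrite in_itv/= => t01; rewrite scale1r scale0r add0r subr0 mulr1 => E.
by exists t.
Qed.

(** * Continuously differentiable functions *)

(** The segment from [x] to [h + x] is replaced by a staircase that changes one
    coordinate at a time.  Each step is a one-dimensional mean value theorem,
    and in the sup norm the staircase stays within distance [`|h|] of [x]. *)
Lemma C1_linear_approx {R : realType} {n : nat} (f : 'rV[R]_n -> R)
    (x h : 'rV[R]_n) (e : R) :
    (forall y, `|y - x| <= `|h| -> forall i : 'I_n,
       derivable f y (delta_mx ord0 i) /\
       `|partial i f y - partial i f x| <= e) ->
  `|f (h + x) - f x - \sum_i h ord0 i * partial i f x| <= n%:R * (e * `|h|).
Proof.
move=> Dh.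
pose y k := \row_i (x ord0 i + (i < k)%:R * h ord0 i) : 'rV[R]_n.
suff H k : (k <= n)%N -> `|f (y k) - f x -
    \sum_(i : 'I_n | (i < k)%N) h ord0 i * partial i f x| <= k%:R * (e * `|h|).
  have := H n (leqnn n); rewrite (_ : y n = h + x); last first.
    by apply/rowP => i; rewrite !mxE ltn_ord mul1r addrC.
  by rewrite (eq_bigl xpredT) // => i; rewrite ltn_ord.
elim: k => [|k IH] kn.
  rewrite big_pred0 // (_ : y 0%N = x) ?subrr ?normr0 ?mul0r //.
  by apply/rowP => i; rewrite !mxE mul0r addr0.
pose k0 := Ordinal kn.
have yS : y k.+1 = h ord0 k0 *: delta_mx ord0 k0 + y k.
  apply/rowP => i; rewrite !mxE eqxx /= ltnS leq_eqVlt.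
  case: (eqVneq i k0) => [->|ik0]; first by rewrite /= !eqxx ltnn /=; ring.
  by rewrite (_ : (i == k :> nat) = false) //=; [ring|exact/negbTE].
have near_x (t : R) : 0 <= t <= 1 ->
    `|t *: (h ord0 k0 *: delta_mx ord0 k0) + y k - x| <= `|h|.
  move=> /andP[t0 t1]; apply: rV_norm_le => // i; rewrite !mxE eqxx /=.
  rewrite -addrA (addrC (x _ _)) addrK.
  apply: le_trans (ler_coord_norm h i).
  have [->|ik0] := eqVneq i k0.
    by rewrite ltnn mul0r addr0 mulr1 normrM ger0_norm // ler_piMl.
  rewrite mulr0 mulr0 add0r normrM ler_piMl //.
  by case: (i < k)%N; rewrite ?normr1 // normr0.
have [t t01 E] : exists2 t : R, 0 <= t <= 1 &
    f (h ord0 k0 *: delta_mx ord0 k0 + y k) - f (y k) =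
    h ord0 k0 * partial k0 f (t *: (h ord0 k0 *: delta_mx ord0 k0) + y k).
  apply: (@mvt_line _ _ _ (fun t : R => h ord0 k0 *
    partial k0 f (t *: (h ord0 k0 *: delta_mx ord0 k0) + y k))) => t t01.
  by apply: is_derive_scalev; apply: derivableP; apply: (Dh _ (near_x t t01) k0).1.
rewrite yS (bigD1 k0) //= (eq_bigl (fun i : 'I_n => (i < k)%N)); last first.
  by move=> i; rewrite ltnS ltn_neqAle andbC.
move: (IH (ltnW kn)) E; set S := \sum_(i | _) _.
set z := _ + y k; set w := _ + y k => {}IH E.
have -> : f z - f x - (h ord0 k0 * partial k0 f x + S) =
    f (y k) - f x - S + h ord0 k0 * (partial k0 f w - partial k0 f x).
  by rewrite mulrBr -E; ring.
apply: le_trans (ler_normD _ _) _; rewrite -natr1 mulrDl mul1r lerD //.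
rewrite normrM mulrC ler_pM //; first exact: (Dh _ (near_x t t01) k0).2.
exact: ler_coord_norm.
Qed.

Definition grad {R : realType} {n : nat} (f : 'rV[R]_n -> R) (x : 'rV[R]_n) :
  'rV[R]_n := \row_i partial i f x.

Definition dot {R : realType} {n : nat} (v w : 'rV[R]_n) : R :=
  \sum_i v ord0 i * w ord0 i.

Lemma cvg_bigsum {R : realType} {T I : Type} {r : seq I} {P : pred I}
    (F : set_system T) (f : I -> T -> R) (a : I -> R) : Filter F ->
  (forall i, P i -> f i x @[x --> F] --> a i) ->
  \sum_(i <- r | P i) f i x @[x --> F] --> \sum_(i <- r | P i) a i.
Proof.
by move=> FF fa; apply: cvg_big => // -[y z]; exact: add_continuous.
Qed.

Lemma dot_continuousl {R : realType} {n : nat} (p : 'rV[R]_n) :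
  continuous (fun v : 'rV[R]_n => dot v p).
Proof.
move=> v; rewrite /dot; apply: (@cvg_bigsum _ _ _ _ _ (nbhs v)) => i _.
by apply: cvgMr_tmp; exact: coord_continuous.
Qed.

Lemma near0_norm_lt {R : realType} {n : nat} (r : R) :
  0 < r -> \forall h \near (0 : 'rV[R]_n), `|h| < r.
Proof. exact: pseudometric_normed_Zmodule.nbhs0_lt. Qed.

(** Smoothness only speaks of partial derivatives, whereas the Jacobian and the
    chain rule along lines need the total derivative. *)
Lemma C1_differentiable {R : realType} {n : nat} (f : 'rV[R]_n -> R) (x : 'rV[R]_n) :
    (\forall y \near x, forall i : 'I_n, derivable f y (delta_mx ord0 i)) ->
    (forall i : 'I_n, {for x, continuous (partial i f)}) ->
  is_diff x f (fun h => dot h (grad f x)).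
Proof.
move=> Df Cf.
pose d h := dot h (grad f x).
have dlin : linear d.
  move=> a v w; rewrite /d /dot scaler_sumr -big_split; apply: eq_bigr => i _.
  by rewrite !mxE mulrDl /= -mulrA.
pose dL := GRing.isLinear.Build _ _ _ _ d dlin.
pose D : {linear 'rV[R]_n -> R} := HB.pack d dL.
have Dc : continuous D by exact: dot_continuousl.
have Do : f \o shift x = cst (f x) + D +o_ (0 : 'rV[R]_n) id.
  apply/eqaddoP => _/posnumP[e] /=.
  have e'0 : 0 < e%:num / (n.+1)%:R by rewrite divr_gt0.
  have Nx : \forall y \near x, forall i : 'I_n, derivable f y (delta_mx ord0 i) /\
       `|partial i f y - partial i f x| <= e%:num / n.+1%:R.
    have Nc : \forall y \near x, forall i : 'I_n,
        `|partial i f y - partial i f x| <= e%:num / n.+1%:R.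
      apply: (@filter_forall _ _ (fun (i : 'I_n) y =>
        `|partial i f y - partial i f x| <= e%:num / n.+1%:R) (nbhs x)) => i.
      have /cvgrPdist_le := Cf i.
      by move=> /(_ _ e'0); apply: filterS => y; rewrite distrC.
    by apply: filterS2 Df Nc => y ? ? i; split.
  have /nbhs_ballP[r /= r0 rN] := Nx.
  near=> h.
  have hr : `|h| < r by near: h; apply/near0_norm_lt.
  have /(_ x h (e%:num / n.+1%:R)) := @C1_linear_approx R n f.
  have Hy y : `|y - x| <= `|h| -> forall i : 'I_n, derivable f y (delta_mx ord0 i) /\
       `|partial i f y - partial i f x| <= e%:num / n.+1%:R.
    move=> yx; apply: rN; rewrite -ball_normE /= distrC.
    exact: le_lt_trans hr.
  move=> /(_ Hy) H.
  rewrite [X in `|X|](_ : _ = f (h + x) - f x - \sum_i h ord0 i * partial i f x).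
    apply: le_trans H _; rewrite mulrA ler_wpM2r // mulrCA ler_piMr //.
    by rewrite ler_pdivrMr // mul1r ler_nat.
  rewrite /= opprD addrA; congr (_ - _).
  by apply: eq_bigr => i _; rewrite mxE.
have E := diff_unique Dc Do.
by split; [apply/diff_locallyP; rewrite E|].
Unshelve. all: by end_near. Qed.

(** * Smooth functions and symmetry of second derivatives *)

Lemma smooth_partial {R : realType} {n : nat} {D : set 'rV[R]_n}
    {f : 'rV[R]_n -> R} (i : 'I_n) :
  smooth_on D f -> smooth_on D (partial i f).
Proof.
move=> sf s x Dx; have := sf (rcons s i) x Dx.
by rewrite /partials foldr_rcons.
Qed.

Lemma smooth_continuous {R : realType} {n : nat} {D : set 'rV[R]_n}
    {f : 'rV[R]_n -> R} {x : 'rV[R]_n} :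
  smooth_on D f -> D x -> {for x, continuous f}.
Proof. by move=> sf /(sf [::])[]. Qed.

Lemma smooth_is_diff {R : realType} {n : nat} {D : set 'rV[R]_n}
    {f : 'rV[R]_n -> R} {x : 'rV[R]_n} :
  open D -> smooth_on D f -> D x -> is_diff x f (fun h => dot h (grad f x)).
Proof.
move=> oD sf Dx; apply: C1_differentiable.
  have : \forall y \near x, D y by apply: open_nbhs_nbhs.
  by apply: filterS => y Dy i; apply: (sf [::] y Dy).2.
by move=> i; apply: smooth_continuous (smooth_partial i sf) Dx.
Qed.

Lemma smooth_is_derive {R : realType} {n : nat} {D : set 'rV[R]_n}
    {f : 'rV[R]_n -> R} {x : 'rV[R]_n} (v : 'rV[R]_n) :
  open D -> smooth_on D f -> D x -> is_derive x v f (dot v (grad f x)).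
Proof.
move=> oD sf Dx; have [df dE] := smooth_is_diff oD sf Dx.
by split; [exact: diff_derivable | rewrite deriveE // dE].
Qed.

Lemma is_derive_translate {R : realType} {n : nat} (f : 'rV[R]_n -> R)
    (x v w : 'rV[R]_n) (d : R) :
  is_derive (x + w) v f d -> is_derive x v (fun y => f (y + w)) d.
Proof.
move=> [df <-].
have E : (fun h => h^-1 *: (((fun y => f (y + w)) \o shift x) (h *: v) - f (x + w)))
    = (fun h : R => h^-1 *: ((f \o shift (x + w)) (h *: v) - f (x + w))).
  by apply/funext => h /=; rewrite addrA.
by split; [rewrite /derivable E | rewrite /derive E].
Qed.

Lemma norm_delta_mx {R : realType} {n : nat} (i : 'I_n) :
  `|delta_mx ord0 i : 'rV[R]_n| <= 1.
Proof.
by apply: rV_norm_le => // j; rewrite mxE eqxx; case: (j == i);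
  rewrite ?normr1 ?normr0.
Qed.

(** Two mean value theorems, first along coordinate [i] and then along
    coordinate [j].  The second difference on the left is symmetric in [i] and
    [j], so both mixed partial derivatives are compared through it. *)
Lemma second_difference {R : realType} {n : nat} (D : set 'rV[R]_n)
    (f : 'rV[R]_n -> R) (x : 'rV[R]_n) (t : R) (i j : 'I_n) :
    open D -> smooth_on D f -> 0 <= t ->
    (forall y, `|y - x| <= t + t -> D y) ->
  exists2 p, `|p - x| <= t + t &
    f (t *: delta_mx ord0 i + x + t *: delta_mx ord0 j) -
    f (t *: delta_mx ord0 i + x) - (f (x + t *: delta_mx ord0 j) - f x) =
    t * (t * partial j (partial i f) p).
Proof.
move=> oD sf t0 Dt.
set ei := delta_mx ord0 i; set ej := delta_mx ord0 j.
have near_x (r s : R) : 0 <= r <= 1 -> 0 <= s <= 1 ->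
    `|r *: (t *: ei) + x + s *: (t *: ej) - x| <= t + t.
  move=> /andP[r0 r1] /andP[s0 s1]; rewrite addrAC addrK.
  have B (k : 'I_n) (q : R) : 0 <= q -> q <= 1 ->
      `|q *: (t *: (delta_mx ord0 k : 'rV[R]_n))| <= t.
    move=> q0 q1; rewrite 2!normrZ !ger0_norm // mulrA -[leRHS]mulr1.
    by rewrite ler_pM // ?mulr_ge0 ?norm_delta_mx // ler_piMl.
  by apply: le_trans (ler_normD _ _) _; rewrite lerD // B.
pose g y := f (y + t *: ej) - f y.
have i01 : 0 <= (0 : R) <= 1 by rewrite lexx ler01.
have i11 : 0 <= (1 : R) <= 1 by rewrite lexx ler01.
have [r r01 Eg] : exists2 r : R, 0 <= r <= 1 & g (t *: ei + x) - g x =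
    t * (partial i f (r *: (t *: ei) + x + t *: ej) -
         partial i f (r *: (t *: ei) + x)).
  apply: (@mvt_line _ _ _ (fun r : R => t *
    (partial i f (r *: (t *: ei) + x + t *: ej) -
         partial i f (r *: (t *: ei) + x)))) => r r01.
  apply: is_derive_scalev; apply: is_deriveB.
    apply: is_derive_translate; apply: derivableP.
    by apply: (sf [::] _ _).2; apply: Dt; rewrite -[t *: ej]scale1r near_x.
  apply: derivableP; apply: (sf [::] _ _).2; apply: Dt.
  by have := near_x _ _ r01 i01; rewrite scale0r addr0.
have [s s01 Es] : exists2 s : R, 0 <= s <= 1 &
    partial i f (t *: ej + (r *: (t *: ei) + x)) - partial i f (r *: (t *: ei) + x) =
    t * partial j (partial i f) (s *: (t *: ej) + (r *: (t *: ei) + x)).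
  apply: (@mvt_line _ _ _ (fun s : R => t *
    partial j (partial i f) (s *: (t *: ej) + (r *: (t *: ei) + x)))) => s s01.
  apply: is_derive_scalev; apply: derivableP.
  by apply: (smooth_partial i sf [::] _ _).2; apply: Dt; rewrite (addrC (s *: _)) near_x.
exists (r *: (t *: ei) + x + s *: (t *: ej)); first exact: near_x.
by rewrite [r *: _ + x + s *: _]addrC -Es [t *: ej + _]addrC -Eg.
Qed.

Lemma partial_comm {R : realType} {n : nat} {D : set 'rV[R]_n}
    {f : 'rV[R]_n -> R} {x : 'rV[R]_n} (i j : 'I_n) :
  open D -> smooth_on D f -> D x ->
  partial j (partial i f) x = partial i (partial j f) x.
Proof.
move=> oD sf Dx; apply/eqP; rewrite -subr_eq0 -normr_le0; apply/ler_addgt0Pr.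
move=> e e0; rewrite add0r.
have e20 : 0 < e / 2 by rewrite divr_gt0.
have N1 k l : \forall y \near x,
    `|partial k (partial l f) x - partial k (partial l f) y| <= e / 2.
  have /cvgrPdist_le := smooth_continuous (smooth_partial k (smooth_partial l sf)) Dx.
  exact: (fun H => H _ e20).
have ND : \forall y \near x, D y by apply: open_nbhs_nbhs.
have NN : \forall y \near x, D y /\
    (`|partial i (partial j f) x - partial i (partial j f) y| <= e / 2 /\
     `|partial j (partial i f) x - partial j (partial i f) y| <= e / 2).
  exact: filterI ND (filterI (N1 i j) (N1 j i)).
have /nbhs_ballP[r /= r0 rN] := NN.
pose t := r / 4.
have t0 : 0 < t by rewrite divr_gt0.
have tr y : `|y - x| <= t + t -> ball x r y.
  move=> yx; rewrite -ball_normE /= distrC (le_lt_trans yx) // /t; lra.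
have Dt y : `|y - x| <= t + t -> D y by move=> /tr /rN [].
have [p px Ep] := @second_difference R n D f x t i j oD sf (ltW t0) Dt.
have [q qx Eq] := @second_difference R n D f x t j i oD sf (ltW t0) Dt.
have E : partial j (partial i f) p = partial i (partial j f) q.
  apply: (mulfI (lt0r_neq0 t0)); apply: (mulfI (lt0r_neq0 t0)).
  apply: etrans (esym Ep) _; apply: etrans Eq.
  have -> : t *: delta_mx ord0 i + x + t *: delta_mx ord0 j =
            t *: delta_mx ord0 j + x + t *: delta_mx ord0 i.
    by rewrite addrAC (addrC (t *: delta_mx ord0 i)) addrAC.
  by rewrite !(addrC x (_ *: _)); ring.
have [_ [_ Hp]] := rN _ (tr _ px); have [_ [Hq _]] := rN _ (tr _ qx).
move: Hp Hq; rewrite E; move: (partial i (partial j f) q) => d.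
move: (partial j _ x) (partial i _ x) => a b Ha Hb.
have -> : a - b = (a - d) - (b - d) by ring.
by apply: le_trans (ler_normB _ _) _; rewrite [leRHS]splitr lerD.
Qed.

(** * Second-order jets and the second derivative test *)

(** The value, the first and the second derivative at [0] of a function of one
    variable.  Jets of sums, products and powers follow from the Leibniz rule,
    so that a second-order condition along a line becomes pure algebra. *)
Definition has_jet {R : realType} (f : R -> R) (a b c : R) :=
  exists f' : R -> R, [/\ \forall t \near (0 : R), is_derive (t : R) 1 f (f' t),
    f 0 = a, f' 0 = b & is_derive (0 : R) 1 f' c].

Lemma is_derive_val {R : realType} {f : R -> R} {t : R} (a b : R) :
  is_derive t 1 f a -> a = b -> is_derive t 1 f b.
Proof. by move=> + <-. Qed.

Section Jets.
Context {R : realType}.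
Implicit Types f g : R -> R.

Lemma has_jet_eq {f g : R -> R} {a b c a' b' c' : R} :
  has_jet f a b c -> f =1 g -> a = a' -> b = b' -> c = c' ->
  has_jet g a' b' c'.
Proof. by move=> + /funext <- <- <- <-. Qed.

Lemma has_jet_affine (a b : R) : has_jet (fun t => a + t * b) a b 0.
Proof.
exists (cst b); split=> //; [|by rewrite mul0r addr0|exact: is_derive_cst].
apply: filterE => t.
have -> : (fun t => a + t * b) = cst a + b *: (id : R -> R).
  by apply/funext => s /=; rewrite fctE /= mulrC.
have H : is_derive t 1 (cst a + b *: (id : R -> R)) (0 + b *: 1).
  by apply: is_deriveD.
by apply: is_derive_val H _; rewrite add0r /GRing.scale /= mulr1.
Qed.

Lemma has_jet_cst (a : R) : has_jet (fun=> a) a 0 0.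
Proof.
by apply: has_jet_eq (has_jet_affine a 0) _ _ _ _ => // t; rewrite mulr0 addr0.
Qed.

Lemma has_jetD {f g} {a b c a' b' c' : R} :
  has_jet f a b c -> has_jet g a' b' c' ->
  has_jet (fun t => f t + g t) (a + a') (b + b') (c + c').
Proof.
move=> [f' [Df <- <- Df']] [g' [Dg <- <- Dg']].
exists (f' + g'); split=> //; last exact: is_deriveD.
by apply: filterS2 Df Dg => t ? ?; exact: is_deriveD.
Qed.

Lemma has_jetM {f g} {a b c a' b' c' : R} :
  has_jet f a b c -> has_jet g a' b' c' ->
  has_jet (fun t => f t * g t) (a * a') (a * b' + b * a')
    (a * c' + 2 * (b * b') + c * a').
Proof.
move=> [f' [Df <- <- Df']] [g' [Dg <- <- Dg']].
exists (f * g' + g * f'); split; last 1 first.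
- have Df0 := nbhs_singleton Df; have Dg0 := nbhs_singleton Dg.
  have H := is_deriveD (is_deriveM Df0 Dg') (is_deriveM Dg0 Df').
  by apply: is_derive_val H _; rewrite /GRing.scale /=; ring.
- by apply: filterS2 Df Dg => t ? ?; exact: is_deriveM.
- by [].
- by congr (_ + _); exact: mulrC.
Qed.

Lemma has_jetZ {f} {a b c : R} (k : R) :
  has_jet f a b c -> has_jet (fun t => k * f t) (k * a) (k * b) (k * c).
Proof.
move=> /(has_jetM (has_jet_cst k)) H.
by apply: has_jet_eq H _ _ _ _ => //; ring.
Qed.

Lemma has_jet_sum {I : Type} {r : seq I} {P : pred I} {f : I -> R -> R}
    {a b c : I -> R} :
  (forall i, P i -> has_jet (f i) (a i) (b i) (c i)) ->
  has_jet (fun t => \sum_(i <- r | P i) f i t) (\sum_(i <- r | P i) a i)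
    (\sum_(i <- r | P i) b i) (\sum_(i <- r | P i) c i).
Proof.
move=> Jf; elim: r => [|i r IH].
  rewrite !big_nil; apply: has_jet_eq (has_jet_cst 0) _ _ _ _ => // t.
  by rewrite big_nil.
rewrite !big_cons; case: ifPn => Pi.
  apply: has_jet_eq (has_jetD (Jf i Pi) IH) _ _ _ _ => // t.
  by rewrite big_cons Pi.
by apply: has_jet_eq IH _ _ _ _ => // t; rewrite big_cons (negbTE Pi).
Qed.

Lemma has_jetX {f} {a b c : R} (n : nat) :
  has_jet f a b c ->
  has_jet (fun t => f t ^+ n.+2) (a ^+ n.+2) (n.+2%:R * a ^+ n.+1 * b)
   (n.+2%:R * (n.+1%:R * a ^+ n * b ^+ 2 + a ^+ n.+1 * c)).
Proof.
move=> Jf; elim: n => [|n IH].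
  apply: has_jet_eq (has_jetM Jf Jf) _ _ _ _ => [t|||];
    by rewrite ?expr2 ?expr1 ?expr0; ring.
apply: has_jet_eq (has_jetM Jf IH) _ _ _ _ => [t|||]; rewrite ?exprS //.
- rewrite -[in RHS](natr1 n.+2); ring.
- rewrite -[in RHS](natr1 n.+2) -(natr1 n.+1) -(natr1 n); ring.
Qed.

(** If [f'] vanishes at [0] and has a positive derivative there, then [f'] is
    positive just to the right of [0], and [f] increases above [f 0 = 0]. *)
Lemma has_jet_max f (b c : R) :
  has_jet f 0 b c -> (\forall t \near (0 : R), f t <= 0) -> b = 0 /\ c <= 0.
Proof.
move=> [f' [Df f0 f'0 Df']] fle.
have NN : \forall t \near (0 : R), is_derive (t : R) 1 f (f' t) /\ f t <= 0.
  exact: filterI Df fle.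
have /nbhs_ballP[r /= r0 rN] := NN.
have inr (t : R) : t \in `](- r), r[%R -> is_derive t 1 f (f' t) /\ f t <= 0.
  by rewrite in_itv /= => tr; apply: rN; rewrite -ball_normE /= sub0r normrN ltr_norml.
have b0 : b = 0.
  have H := @derive1_at_max R f (- r) r 0.
  have : is_derive (0 : R) 1 f 0.
    apply: H; first by rewrite lerNl -subr_ge0 opprK addr_ge0 ?ltW.
    - by move=> t /inr[[]].
    - by rewrite in_itv /= oppr_lt0 r0.
    - by move=> t /inr[_]; rewrite f0.
  case=> _ <-; rewrite -f'0; have [] := nbhs_singleton Df.
  by move=> _ ->.
split=> //; rewrite leNgt; apply/negP => c0.
move: Df' => [D2 D2E].
have /cvgrPdist_lt /(_ c c0) :
    (fun h => h^-1 *: ((f' \o shift 0) (h *: 1) - f' 0)) @ (0 : R)^' --> c.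
  by rewrite -D2E.
move=> /= Nc.
have [d /= d0 dN] := Nc.
pose h := Num.min (r / 2) (d / 2).
have h0 : 0 < h by rewrite lt_min !divr_gt0.
have hr : h < r by rewrite gt_min ltr_pdivrMr // ltr_pMr // ltr1n.
have hd : h < d by rewrite gt_min orbC ltr_pdivrMr // ltr_pMr // ltr1n.
have f'pos (t : R) : 0 < t -> t < d -> 0 < f' t.
  move=> t0 td.
  have := dN t; rewrite /ball_ /= sub0r normrN (gtr0_norm t0) => /(_ td (lt0r_neq0 t0)).
  rewrite [_%:A]mulr1 addr0 f'0 b0 subr0 => H.
  have : 0 < t^-1 * f' t by move: H; rewrite ltr_norml => /andP[_]; rewrite gtrBl.
  by rewrite pmulr_rgt0 ?invr_gt0.
have [||t] := @MVT R f f' 0 h h0.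
- move=> t; rewrite in_itv /= => /andP[t0 th].
  by apply: (inr t _).1; rewrite in_itv /= (lt_trans th hr) (lt_trans _ t0) // oppr_lt0.
- apply: derivable_within_continuous => t; rewrite in_itv /= => /andP[t0 th].
  have [] // := (inr t _).1; rewrite in_itv /= (le_lt_trans th hr) (lt_le_trans _ t0) //.
  by rewrite oppr_lt0.
rewrite in_itv /= f0 !subr0 => /andP[t0 th] E.
have : 0 < f h by rewrite E mulr_gt0 // f'pos // (lt_trans th).
by rewrite ltNge (inr h _).2 // in_itv /= hr andbT (lt_trans _ h0) // oppr_lt0.
Qed.

Lemma near_line {n : nat} {x : 'rV[R]_n} (v : 'rV[R]_n) {P : set 'rV[R]_n} :
  (\forall y \near x, P y) -> \forall t \near (0 : R), P (t *: v + x).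
Proof.
move=> NP; have Cl : {for 0, continuous (fun t : R => t *: v + x)}.
  by apply: cvgD; [exact: scalel_continuous | exact: cvg_cst].
by apply: Cl; rewrite scale0r add0r.
Qed.

Lemma has_jet_line {n : nat} {D : set 'rV[R]_n} {F : 'rV[R]_n -> R}
    {x : 'rV[R]_n} (v : 'rV[R]_n) :
  open D -> smooth_on D F -> D x ->
  has_jet (fun t => F (t *: v + x)) (F x) (dot v (grad F x))
    (dot v (\row_i dot v (grad (partial i F) x))).
Proof.
move=> oD sF Dx.
exists (fun t => dot v (grad F (t *: v + x))); split.
- have ND : \forall y \near x, D y by apply: open_nbhs_nbhs.
  apply: filterS (near_line v ND) => t Dt; apply: line_is_derive.
  exact: (smooth_is_derive v oD sF Dt).
- by rewrite scale0r add0r.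
- by rewrite scale0r add0r.
- have -> : (fun t => dot v (grad F (t *: v + x))) =
      \sum_(i < n) (v ord0 i \*: (fun t => partial i F (t *: v + x))).
    by apply/funext => t; rewrite fct_sumE; apply: eq_bigr => i _; rewrite mxE.
  apply: (@is_derive_val _ _ _ (\sum_(i < n) v ord0 i *:
      dot v (grad (partial i F) x))); last first.
    by apply: eq_bigr => i _; rewrite mxE.
  apply: is_derive_sum => i; apply: is_deriveZ; apply: line_is_derive.
  rewrite scale0r add0r; exact: (smooth_is_derive v oD (smooth_partial i sF) Dx).
Qed.

End Jets.

(** * Essential and pointwise bounds *)

(** Integrate the pointwise inequality over [a, b]; the series and the integral
    are exchanged by monotone convergence. *)
Lemma weighted_interval_cover {R : realType} (a b V : R) (A B w : nat -> R) :
    a <= b -> 0 <= V -> (forall k, A k <= B k) -> (forall k, 0 <= w k) ->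
    (forall t, a <= t <= b ->
      (V%:E <= \sum_(0 <= k <oo) (w k * (A k <= t <= B k)%R%:R)%:E)%E) ->
  ((V * (b - a))%:E <= \sum_(0 <= k <oo) (w k * (B k - A k))%:E)%E.
Proof.
move=> ab V0 AB w0 cov.
pose mu := @lebesgue_measure R.
have muI (p q : R) : p <= q -> mu `[p, q]%classic = (q - p)%:E.
  rewrite le_eqVlt => /predU1P[->|pq].
    by rewrite /mu lebesgue_measure_itv /= ltxx subrr.
  by rewrite /mu lebesgue_measure_itv /= lte_fin pq.
pose F k (t : measurableTypeR R) := ((w k)%:E * (\1_(`[A k, B k]) t)%:E)%E.
have F0 k t : (0 <= F k t)%E by rewrite /F -EFinM lee_fin mulr_ge0 ?P0 ?ler0n ?lee_fin.
have mF k : measurable_fun (`[a, b]%classic : set (measurableTypeR R)) (F k).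
  by apply: measurable_funeM; apply/measurable_EFinP; exact: measurable_indic.
have mS : measurable_fun (`[a, b]%classic : set (measurableTypeR R))
    (fun t => \sum_(0 <= k <oo) F k t)%E.
  by apply: ge0_emeasurable_sum.
have -> : (V * (b - a))%:E =
    (\int[mu]_(t in (`[a, b]%classic : set (measurableTypeR R))) (cst V%:E) t)%E.
  by rewrite integral_cst // [X in (_ * X)%E](muI _ _ ab) EFinM.
apply: (@le_trans _ _ (\int[mu]_(t in (`[a, b]%classic : set (measurableTypeR R)))
    (\sum_(0 <= k <oo) F k t))%E).
  apply: ge0_le_integral => //.
  move=> t; rewrite /= in_itv /= => /cov /le_trans; apply.
    apply: lee_nneseries => k _; first by rewrite lee_fin mulr_ge0 ?P0 ?ler0n ?lee_fin.
    by rewrite /F -EFinM lee_fin indicE mem_setE /= in_itv.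
rewrite integral_nneseries //; apply: lee_nneseries => k _.
  by move=> _; apply: integral_ge0.
rewrite ge0_integralZl_EFin //; last first.
  by apply/measurable_EFinP; exact: measurable_indic.
rewrite integral_indic // EFinM -muI // lee_wpmul2l ?lee_fin //.
by apply: le_measure; rewrite ?inE //; exact: measurableI.
Qed.

(** Countable subadditivity of the volume of boxes, by induction on the dimension:
    the slice of the covered box at height [t] is covered by the slices of the
    boxes whose last side contains [t], and the resulting inequality is
    integrated in [t].  The set [S] of admissible boxes makes room for this
    restriction in the induction hypothesis.  Points are functions on [nat] so
    that a slice is obtained by overriding one coordinate. *)
Lemma box_volume_le {R : realType} n (a b : nat -> R) (A B : nat -> nat -> R)
    (S : nat -> bool) :
    (forall i, a i <= b i) -> (forall k i, A k i <= B k i) ->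
    (forall x : nat -> R, (forall i, (i < n)%N -> a i <= x i <= b i) ->
       exists2 k, S k & forall i, (i < n)%N -> A k i <= x i <= B k i) ->
  ((\prod_(i < n) (b i - a i))%:E <=
     \sum_(0 <= k <oo) ((S k)%:R * \prod_(i < n) (B k i - A k i))%:E)%E.
Proof.
move=> ab AB; have P0 k m : 0 <= \prod_(i < m) (B k i - A k i).
  by apply: prodr_ge0 => i _; rewrite subr_ge0.
elim: n S => [|n IH] S cov.
  have [k Sk _] := cov a (fun i => ltac:(by [])).
  rewrite big_ord0; apply: le_trans (nneseries_lim_ge k.+1 _); last first.
    by move=> i _ _; rewrite lee_fin mulr_ge0 ?P0 ?ler0n ?lee_fin.
  rewrite big_nat_recr //= Sk big_ord0 mul1r leeDr // sume_ge0 // => i _.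
  by rewrite lee_fin mulr_ge0 ?P0 ?ler0n ?lee_fin.
rewrite big_ord_recr /=.
under eq_eseriesr do rewrite big_ord_recr /= mulrA.
apply: (@weighted_interval_cover _ _ _ _ (A ^~ n) (B ^~ n)
  (fun k => (S k)%:R * \prod_(i < n) (B k i - A k i))) => //.
- by apply: prodr_ge0 => i _; rewrite subr_ge0.
- by move=> k; rewrite mulr_ge0 ?P0 ?ler0n.
move=> t tab.
apply: le_trans (IH (fun k => S k && (A k n <= t <= B k n)) _) _.
  move=> x xab.
  have [|k Sk Hk] := cov (fun i => if i == n then t else x i).
    move=> i; rewrite ltnS leq_eqVlt; case: eqP => [-> _|_ /= /xab //] //.
  exists k; first by rewrite Sk; have := Hk n (ltnSn n); rewrite eqxx.
  by move=> i ni; have := Hk i (ltnW ni); rewrite (ltn_eqF ni).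
apply: lee_nneseries => k _; first by rewrite lee_fin mulr_ge0 ?P0 ?ler0n ?lee_fin.
by rewrite lee_fin mulrAC -natrM mulnb.
Qed.

Lemma cube_not_null {R : realType} {n : nat} (A : set 'rV[R]_n)
    (x : 'rV[R]_n) (r : R) :
  0 < r -> (forall y, `|y - x| <= r -> A y) -> ~ lebesgue_null A.
Proof.
move=> r0 rA nA.
have r20 : 0 < (r + r) ^+ n by rewrite exprn_gt0 // addr_gt0.
have e0 : 0 < (r + r) ^+ n / 2 by rewrite divr_gt0.
have [p [q [pq cov vol]]] := nA _ e0.
pose ext (v : 'rV[R]_n) (i : nat) := if insub i is Some j then v ord0 j else 0.
have extE v (i : 'I_n) : ext v i = v ord0 i by rewrite /ext valK.
have ab i : ext x i - r <= ext x i + r by rewrite lerD2l ge0_cp // ltW.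
have AB k i : ext (p k) i <= ext (q k) i.
  by rewrite /ext; case: insub => // j; rewrite lexx.
have cov' (y : nat -> R) :
    (forall i, (i < n)%N -> ext x i - r <= y i <= ext x i + r) ->
    exists2 k, xpredT k & forall i, (i < n)%N -> ext (p k) i <= y i <= ext (q k) i.
  move=> yx; have [|k _ Hk] := cov (\row_(j < n) y j).
    apply: rA; apply: rV_norm_le; rewrite ?ltW // => i; rewrite !mxE.
    by have := yx i (ltn_ord i); rewrite extE ler_distl.
  exists k => // i ni; have := Hk (Ordinal ni); rewrite mxE.
  by rewrite -(extE (p k)) -(extE (q k)).
have := @box_volume_le R n _ _ _ _ xpredT ab AB cov'.
rewrite (eq_bigr (fun=> r + r)); last first.
  by move=> i _; ring.
rewrite prodr_const card_ord leNgt => /negP; apply.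
apply: (@le_lt_trans _ _ ((r + r) ^+ n / 2)%:E).
  apply: le_trans vol; apply: lee_nneseries => k _.
    move=> _; rewrite lee_fin mul1r; apply: prodr_ge0 => i _.
    by rewrite !extE subr_ge0.
  rewrite mul1r lee_fin le_eqVlt; apply/orP; left; apply/eqP.
  by apply: eq_bigr => i _; rewrite !extE.
by rewrite lte_fin ltr_pdivrMr // ltr_pMr // ltr1n.
Qed.

(** For a function continuous at [x], exceeding the essential bound at [x] means
    exceeding it on a small cube, which is not a null set. *)
Lemma Linfty_norm_pointwise {R : realType} {n : nat} {D : set 'rV[R]_n}
    {f : 'rV[R]_n -> R} {x : 'rV[R]_n} (c : R) :
    open D -> D x -> {for x, continuous f} ->
  (Linfty_norm D f <= c%:E)%E -> `|f x| <= c.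
Proof.
move=> oD Dx cf fc; rewrite leNgt; apply/negP => cfx.
have : (Linfty_norm D f < `|f x|%:E)%E by apply: le_lt_trans fc _; rewrite lte_fin.
move=> /ereal_inf_lt[_ [d [d0 dnull] <-]]; rewrite lte_fin => dfx.
have ND : \forall y \near x, D y by apply: open_nbhs_nbhs.
have Nf : \forall y \near x, d < `|f y|.
  have /cvgrPdist_lt /(_ (`|f x| - d)) := cf; rewrite subr_gt0 => /(_ dfx).
  apply: filterS => y fxy; have := lerB_dist (f x) (f y).
  by move=> /le_lt_trans /(_ fxy); rewrite ltrD2l ltrN2.
have NN : \forall y \near x, D y /\ d < `|f y| by exact: filterI ND Nf.
have /nbhs_ballP[r /= r0 rN] := NN.
apply: (@cube_not_null R n _ x (r / 2) _ _ dnull); first by rewrite divr_gt0.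
move=> y yx; apply: rN; rewrite -ball_normE /= distrC (le_lt_trans yx) //.
by rewrite ltr_pdivrMr // ltr_pMr // ltr1n.
Qed.

(** * The induced metric of a graph and a frame for its inverse *)

Section Dot.
Context {R : realType}.

Lemma dotC {n} (v w : 'rV[R]_n) : dot v w = dot w v.
Proof. by apply: eq_bigr => i _; rewrite mulrC. Qed.

Lemma dotDl {n} (u v w : 'rV[R]_n) : dot (u + v) w = dot u w + dot v w.
Proof.
by rewrite /dot -big_split; apply: eq_bigr => i _; rewrite mxE mulrDl.
Qed.

Lemma dotZl {n} (a : R) (v w : 'rV[R]_n) : dot (a *: v) w = a * dot v w.
Proof. by rewrite /dot big_distrr; apply: eq_bigr => i _; rewrite mxE /= mulrA. Qed.

Lemma dotDr {n} (u v w : 'rV[R]_n) : dot u (v + w) = dot u v + dot u w.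
Proof. by rewrite !(dotC u) dotDl. Qed.

Lemma dotZr {n} (a : R) (v w : 'rV[R]_n) : dot v (a *: w) = a * dot v w.
Proof. by rewrite !(dotC v) dotZl. Qed.

Lemma dotNl {n} (v w : 'rV[R]_n) : dot (- v) w = - dot v w.
Proof. by rewrite -scaleN1r dotZl mulN1r. Qed.

Lemma dotNr {n} (v w : 'rV[R]_n) : dot v (- w) = - dot v w.
Proof. by rewrite !(dotC v) dotNl. Qed.

Lemma dot0l {n} (w : 'rV[R]_n) : dot 0 w = 0.
Proof. by rewrite -(scale0r 0) dotZl mul0r. Qed.

Definition dotE := (@dotDl, @dotDr, @dotZl, @dotZr, @dotNl, @dotNr).

Lemma dot_sumr {n} (I : finType) (v : 'rV[R]_n) (w : I -> 'rV[R]_n) :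
  dot v (\sum_i w i) = \sum_i dot v (w i).
Proof.
rewrite /dot exchange_big; apply: eq_bigr => i _.
by rewrite summxE big_distrr.
Qed.

Lemma dot_mulmx {n m} (v : 'rV[R]_n) (M : 'M[R]_(n, m)) (w : 'rV[R]_m) :
  dot (v *m M) w = dot v (w *m M^T).
Proof.
rewrite /dot; under eq_bigr do rewrite mxE big_distrl /=.
rewrite exchange_big; apply: eq_bigr => i _; rewrite mxE big_distrr /=.
by apply: eq_bigr => j _; rewrite mxE; ring.
Qed.

Lemma dot_ge0 {n} (v : 'rV[R]_n) : 0 <= dot v v.
Proof. by apply: sumr_ge0 => i _; rewrite -expr2 sqr_ge0. Qed.

Lemma dot_eq0 {n} {v : 'rV[R]_n} : dot v v = 0 -> v = 0.
Proof.
move=> /eqP; rewrite psumr_eq0 => [/allP v0|i _]; last by rewrite -expr2 sqr_ge0.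
apply/rowP => i; have := v0 i (mem_index_enum i).
by rewrite mxE -expr2 sqrf_eq0 => /eqP.
Qed.

Lemma dot_cauchy {n} (v w : 'rV[R]_n) : dot v w ^+ 2 <= dot v v * dot w w.
Proof.
have [w0|w0] := eqVneq (dot w w) 0.
  by rewrite (dot_eq0 w0) dotC dot0l expr0n /= dot0l mulr0.
have wp : 0 < dot w w by rewrite lt_neqAle eq_sym w0 dot_ge0.
have := dot_ge0 (dot w w *: v - dot v w *: w).
rewrite !dotE (dotC w v) => H.
have {}H : 0 <= dot w w * (dot v v * dot w w - dot v w ^+ 2) by nra.
by rewrite -subr_ge0; move: H; rewrite pmulr_rge0.
Qed.

Lemma dot_delta {n} (i : 'I_n) (v : 'rV[R]_n) : dot (delta_mx ord0 i) v = v ord0 i.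
Proof.
rewrite /dot (bigD1 i) //= mxE !eqxx mul1r big1 ?addr0 // => j ji.
by rewrite mxE (negbTE ji) mul0r.
Qed.

Lemma dot_extr {n} (v w : 'rV[R]_n) : (forall z, dot z v = dot z w) -> v = w.
Proof. by move=> H; apply/rowP => i; have := H (delta_mx ord0 i); rewrite !dot_delta. Qed.

Lemma coord_sqr_le_dot {n} (v : 'rV[R]_n) i : v ord0 i ^+ 2 <= dot v v.
Proof.
rewrite /dot (bigD1 i) //= expr2 lerDl; apply: sumr_ge0 => j _.
by rewrite -expr2 sqr_ge0.
Qed.

Lemma trace_dot {n m} (M N : 'M[R]_(n, m)) :
  \sum_k dot (row k M) (row k N) = \tr (M *m N^T).
Proof.
apply: eq_bigr => k _; rewrite mxE.
by apply: eq_bigr => j _; rewrite !mxE.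
Qed.

End Dot.

Section GraphMetric.
Context {R : realType} {n m : nat} (A : 'M[R]_(n, m)).

(** The induced metric [g] of a graph whose differential is [v |-> v *m A]. *)
Definition graph_metric : 'M[R]_n := 1%:M + A *m A^T.
Local Notation X := (invmx graph_metric).

Lemma graph_metric_sym : graph_metric^T = graph_metric.
Proof. by rewrite /graph_metric linearD /= trmx1 trmx_mul trmxK. Qed.

Lemma dot_graph_metric (v w : 'rV[R]_n) :
  dot (v *m graph_metric) w = dot v w + dot (v *m A) (w *m A).
Proof.
by rewrite /graph_metric mulmxDr mulmx1 dotDl mulmxA dot_mulmx trmxK.
Qed.

Lemma graph_metric_unit : graph_metric \in unitmx.
Proof.
rewrite -row_free_unit -kermx_eq0; apply/eqP/row_matrixP => i.
rewrite row0; apply: dot_eq0; apply/eqP; rewrite eq_le dot_ge0 andbT.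
have := dot_graph_metric (row i (kermx graph_metric)) (row i (kermx graph_metric)).
rewrite -row_mul mulmx_ker row0 dot0l.
by have := dot_ge0 (row i (kermx graph_metric) *m A); lra.
Qed.

Lemma inv_graph_metric_sym : X^T = X.
Proof. by rewrite trmx_inv graph_metric_sym. Qed.

(** The rows [v_k] of this matrix satisfy [\sum_k v_k^T *m v_k = g^-1], because
    [g^-1 = g^-1 *m g *m g^-1] and [g = 1 + A *m A^T].  A contraction with
    [g^-1] is thus a sum of values of the contracted form on the vectors [v_k],
    and a second-order condition valid in every direction can be summed
    without diagonalising [g]. *)
Definition frame : 'M[R]_(n + m, n) := col_mx X (A^T *m X).

Lemma frameP : frame^T *m frame = X.
Proof.
rewrite /frame tr_col_mx mul_row_col trmx_mul trmxK inv_graph_metric_sym.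
rewrite -mulmxA (mulmxA A) -mulmxDr -[X in X + _]mul1mx -mulmxDl.
by rewrite -/graph_metric mulmxV ?graph_metric_unit // mulmx1.
Qed.

Lemma frame_sum {p} (M N : 'M[R]_(n, p)) :
  \sum_k dot (row k frame *m M) (row k frame *m N) = \tr (X *m (M *m N^T)).
Proof.
under eq_bigr do rewrite -!row_mul.
rewrite trace_dot trmx_mul -mulmxA mxtrace_mulC -!mulmxA frameP.
by rewrite mxtrace_mulC -mulmxA mxtrace_mulC -mulmxA.
Qed.

Lemma frame_dot_sum (y z : 'rV[R]_n) :
  \sum_k dot (row k frame) y * dot (row k frame) z = dot (y *m X) z.
Proof.
have E (v w : 'rV[R]_n) : dot v w = \tr (v *m w^T).
  by rewrite trace_mx11 mxE; apply: eq_bigr => i _; rewrite mxE.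
rewrite [RHS]dotC E trmx_mul inv_graph_metric_sym mxtrace_mulC -mulmxA.
rewrite -[in RHS](trmxK z) -frame_sum; apply: eq_bigr => k _.
by rewrite !E !trace_mx11 /dot big_ord1.
Qed.

(** This is the trace of [g^-1 *m g], split along [g = 1 + A *m A^T]. *)
Lemma frame_energy :
  \sum_k dot (row k frame) (row k frame) +
  \sum_k dot (row k frame *m A) (row k frame *m A) = n%:R.
Proof.
rewrite frame_sum.
have := frame_sum 1%:M 1%:M; under eq_bigr do rewrite !mulmx1.
move=> ->; rewrite trmx1 mulmx1 -mxtraceD -mulmxDr -/graph_metric.
by rewrite mulVmx ?graph_metric_unit // mxtrace1.
Qed.

End GraphMetric.

(** * Linear algebra at a top singular vector *)

(** Here [e] is a unit eigenvector of [A *m A^T] with eigenvalue [L], and [area]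
    expresses that [A] is area-decreasing on the planes that contain [e]: the
    operator norm of [A] on the orthogonal complement of [e] is at most
    [1 / sqrt L]. *)
Section TopSingularVector.
Context {R : realType} {n m : nat} {A : 'M[R]_(n, m)} {e : 'rV[R]_n} {L : R}.
Context (L0 : 0 < L) (e1 : dot e e = 1).
Context (eig : forall z, dot (z *m A) (e *m A) = L * dot z e).
Context (area : forall z, dot z e = 0 ->
  L * dot (z *m A) (z *m A) <= dot z z).
Local Notation g := (graph_metric A).
Local Notation X := (invmx g).

Lemma top_inv_metric : e *m X = (1 + L)^-1 *: e.
Proof.
have L1 : 1 + L != 0 by rewrite gt_eqF // addr_gt0.
have E : e *m g = (1 + L) *: e.
  apply: dot_extr => z; rewrite (dotC z (e *m g)) dot_graph_metric (dotC _ (z *m A)).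
  by rewrite eig dotZr (dotC e) mulrDl mul1r.
apply: (scalerI L1); rewrite scalerA divff // scale1r scalemxAl -E.
by rewrite mulmxK // graph_metric_unit.
Qed.

Lemma top_norm : dot (e *m A) (e *m A) = L.
Proof. by rewrite eig e1 mulr1. Qed.

(** Cauchy-Schwarz against [e *m A] bounds each term from below by
    [L * (dot v_k e) ^+ 2], and these add up to [L * dot (e *m g^-1) e]. *)
Lemma frame_energy_ge : L / (1 + L) <=
  \sum_k dot (row k (frame A) *m A) (row k (frame A) *m A).
Proof.
have : \sum_k dot (row k (frame A)) e * dot (row k (frame A)) e = (1 + L)^-1.
  by rewrite frame_dot_sum top_inv_metric dotZl e1 mulr1.
move=> E; rewrite -E big_distrr /=; apply: ler_sum => k _.
have := dot_cauchy (row k (frame A) *m A) (e *m A).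
by rewrite top_norm eig exprMn expr2 -mulrA (mulrC _ L) ler_pM2l.
Qed.

(** The component of [x *m g^-1] along [e] carries a factor [(1 + L)^-1], while
    [A] shrinks the component orthogonal to [e] by [sqrt L]; both contributions
    are therefore of size [1 / sqrt L]. *)
Lemma cross_bound (x : 'rV[R]_n) : dot x x <= 1 ->
  dot (x *m X *m A) (x *m X *m A) <= 4 / L.
Proof.
move=> x1; set z := x *m X.
have zx : dot z z <= 1.
  have xz : x = z + z *m A *m A^T.
    by rewrite -mulmxA -[X in X + _]mulmx1 -mulmxDr mulmxKV // graph_metric_unit.
  apply: le_trans x1; rewrite [in leRHS]xz !dotE.
  have E : dot (z *m A *m A^T) z = dot (z *m A) (z *m A).
    by rewrite dot_mulmx trmxK.
  rewrite (dotC z (z *m A *m A^T)) E.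
  have := dot_ge0 (z *m A); have := dot_ge0 (z *m A *m A^T); lra.
have ze : dot z e = (1 + L)^-1 * dot x e.
  by rewrite /z dot_mulmx inv_graph_metric_sym top_inv_metric dotZr.
have xe : dot x e ^+ 2 <= 1.
  by apply: le_trans (dot_cauchy x e) _; rewrite e1 mulr1.
pose c := dot z e; pose w := z - c *: e.
have we : dot w e = 0 by rewrite /w !dotE e1 -/c mulr1 subrr.
have ww : dot w w <= 1.
  apply: le_trans zx; rewrite /w !dotE e1 (dotC e) -/c.
  have := sqr_ge0 c; rewrite expr2; lra.
have wA := area w we.
have wAe : dot (w *m A) (e *m A) = 0 by rewrite eig we mulr0.
have -> : z *m A = w *m A + c *: (e *m A) by rewrite /w mulmxBl -scalemxAl subrK.
rewrite !dotE (dotC (e *m A)) wAe top_norm.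
rewrite ler_pdivlMr // !mulr0 addr0 add0r.
have cL : c * L * (c * L) <= 1.
  rewrite -expr2 /c ze exprMn exprMn.
  have -> : (1 + L)^-1 ^+ 2 * dot x e ^+ 2 * L ^+ 2 =
     (L / (1 + L)) ^+ 2 * dot x e ^+ 2 by rewrite exprMn; ring.
  have r0 : 0 <= L / (1 + L) by rewrite divr_ge0 ?ltW ?addr_gt0.
  have r1 : L / (1 + L) <= 1 by rewrite ler_pdivrMr ?addr_gt0 // mul1r lerDr.
  by rewrite -[leRHS]mulr1 ler_pM ?sqr_ge0 // exprn_ile1.
rewrite mulrDl.
have -> : c * (c * L) * L = c * L * (c * L) by ring.
rewrite mulrC; lra.
Qed.

(** The algebraic heart of the estimate.  In the application [H = D^2 u (e, v)]
    and [B] is the covector [w |-> <e A, D^2 u (v, w)>]; the right-hand side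
    collects the terms of the second variation when [e] is rotated with speed
    [z] while the base point moves with speed [v]; the term with [B g^-1 A] is
    what the differentiated system leaves of the third derivatives.  The choice
    [z = L^-1 (B - s e) g^-1] turns it into
    [2 |H + (1 + L) z A|^2 + 2 L (|z|^2 - L |z A|^2) + 4 s^2 / (1 + L)].  The
    middle bracket is nonnegative exactly because [A] is area-decreasing, and
    Cauchy-Schwarz against [e A] bounds the square from below by
    [2 s^2 / L], since [z A] is orthogonal to [e A]. *)
Lemma key_ineq (B : 'rV[R]_n) (H : 'rV[R]_m) (s : R) :
    dot B e = s -> dot H (e *m A) = s ->
  exists2 z : 'rV[R]_n, dot z e = 0 &
    6 / (1 + L) * s ^+ 2 <=
    2 * dot H H + 4 * dot H (B *m X *m A) + 4 * (dot B z + dot (z *m A) H)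
    + 2 * (dot z z + dot (z *m A) (z *m A)) - 2 * (1 + L) * dot z z.
Proof.
move=> Be Hs; set w := (B - s *: e) *m X.
have we : dot w e = 0.
  by rewrite /w dot_mulmx inv_graph_metric_sym top_inv_metric dotZr !dotE e1 Be; ring.
have Bw : B = w *m g + s *: e.
  by rewrite /w mulmxKV ?subrK // graph_metric_unit.
(* After completing the square in [H], the lower bound depends on [z] through
   [2 dot w z - L * dot z z], which is largest at [z = L^-1 w]. *)
have [z wz] : exists z, w = L *: z.
  by exists (L^-1 *: w); rewrite scalerA divff ?scale1r ?gt_eqF.
have ze : dot z e = 0.
  by apply: (mulfI (lt0r_neq0 L0)); rewrite -dotZl -wz we mulr0.
exists z => //.
have Bz : dot B z = L * (dot z z + dot (z *m A) (z *m A)).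
  by rewrite Bw dotDl dot_graph_metric wz !dotE -scalemxAl !dotE (dotC e) ze; ring.
have BX : B *m X *m A = L *: (z *m A) + (s / (1 + L)) *: (e *m A).
  rewrite Bw mulmxDl mulmxK ?graph_metric_unit // -scalemxAl top_inv_metric.
  by rewrite scalerA mulmxDl wz -!scalemxAl.
have zA := area z ze; have zAe : dot (z *m A) (e *m A) = 0 by rewrite eig ze mulr0.
move: (z *m A) zA zAe Bz BX => h zA zAe Bz BX.
rewrite BX Bz !dotE Hs (dotC h H).
have CS := dot_cauchy (H + (1 + L) *: h) (e *m A).
move: CS; rewrite top_norm !dotE Hs zAe (dotC h H) mulr0 addr0 => CS.
have L1 : 0 < 1 + L by rewrite addr_gt0.
have sL : 6 / (1 + L) * s ^+ 2 <= 2 * (s ^+ 2 / L) + 4 * (s / (1 + L) * s).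
  have -> : 4 * (s / (1 + L) * s) = 4 / (1 + L) * s ^+ 2 by ring.
  have : s ^+ 2 / (1 + L) <= s ^+ 2 / L.
    by rewrite ler_wpM2l ?sqr_ge0 // lef_pV2 ?posrE // lerDr.
  have -> : 6 / (1 + L) * s ^+ 2 = 6 * (s ^+ 2 / (1 + L)) by ring.
  have -> : 4 / (1 + L) * s ^+ 2 = 4 * (s ^+ 2 / (1 + L)) by ring.
  lra.
apply: le_trans sL _.
have {}CS : s ^+ 2 / L <= dot H H + 2 * (1 + L) * dot H h + (1 + L) ^+ 2 * dot h h.
  by rewrite ler_pdivrMr //; apply: le_trans CS _; rewrite le_eqVlt; apply/orP; left;
    apply/eqP; ring.
have {}zA : L * (L * dot h h) <= L * dot z z by rewrite ler_pM2l.
rewrite expr2 in CS; lra.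
Qed.
End TopSingularVector.

(** * Differentiating an identity that involves an inverse matrix *)

Lemma is_derive_bigsum {R : realType} {I : Type} (r : seq I) (P : pred I)
    (f : I -> R -> R) (d : I -> R) (t : R) :
  (forall i, is_derive t 1 (f i) (d i)) ->
  is_derive t 1 (fun s => \sum_(i <- r | P i) f i s) (\sum_(i <- r | P i) d i).
Proof.
move=> Df; rewrite (_ : (fun s => _) = \sum_(i <- r | P i) f i); last first.
  by apply/funext => s; rewrite fct_sumE.
elim/big_ind2 : _ => [|f1 d1 f2 d2 ? ?|//]; first exact: is_derive_cst.
exact: is_deriveD.
Qed.

Lemma derivable_bigprod {R : realType} {I : Type} (r : seq I) (P : pred I)
    (f : I -> R -> R) (t : R) :
  (forall i, derivable (f i) t 1) ->
  derivable (fun s => \prod_(i <- r | P i) f i s) t 1.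
Proof.
move=> Df; elim: r => [|i r IH].
  rewrite (_ : (fun s => _) = cst 1); first exact: derivable_cst.
  by apply/funext => s; rewrite big_nil.
rewrite (_ : (fun s => _) = (fun s => (if P i then f i s else 1) *
    \prod_(i <- r | P i) f i s)); last first.
  by apply/funext => s; rewrite big_cons; case: ifP; rewrite ?mul1r.
apply: derivableM; last exact: IH.
by case: (P i); [exact: Df|exact: derivable_cst].
Qed.

Lemma derivable_det {R : realType} {n : nat} (M : R -> 'M[R]_n) (t : R) :
  (forall i j, derivable (fun s => M s i j) t 1) ->
  derivable (fun s => \det (M s)) t 1.
Proof.
move=> DM; rewrite /determinant.
have D (p : {perm 'I_n}) : derivable (fun s => (-1) ^+ p * \prod_i M s i (p i)) t 1.
  apply: derivableM; first exact: derivable_cst.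
  by apply: derivable_bigprod.
by have [] := @is_derive_bigsum R _ (index_enum _) xpredT _
  (fun p : {perm 'I_n} => 'D_1 (fun s : R => (-1) ^+ p * \prod_i M s i (p i)) t) t
  (fun p => derivableP (D p)).
Qed.

Lemma derivable_invmx {R : realType} {n : nat} (M : R -> 'M[R]_n) (t : R) :
    (forall i j, derivable (fun s => M s i j) t 1) ->
    (\forall s \near t, M s \in unitmx) ->
  forall i j, derivable (fun s => invmx (M s) i j) t 1.
Proof.
move=> DM uM i j.
apply: (@near_eq_derivable _ _ _ (fun s => (\det (M s))^-1 * cofactor (M s) j i)).
  by apply: filterS uM => s us; rewrite /invmx us !mxE.
apply: derivableM.
  apply: derivableV; last exact: derivable_det.
  by rewrite -unitfE -unitmxE; exact: nbhs_singleton uM.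
apply: derivableM; first exact: derivable_cst.
apply: derivable_det => k l.
rewrite (_ : (fun s => _) = (fun s => M s (lift j k) (lift i l))) //.
by apply/funext => s; rewrite !mxE.
Qed.

Lemma is_derive_unique {R : realType} (f : R -> R) (t a b : R) :
  is_derive t 1 f a -> is_derive t 1 f b -> a = b.
Proof. by move=> [_ <-] [_ <-]. Qed.

Lemma is_derive_mulmx {R : realType} {m n p : nat} (M : R -> 'M[R]_(m, n))
    (N : R -> 'M[R]_(n, p)) (M' : 'M[R]_(m, n)) (N' : 'M[R]_(n, p)) (t : R) :
    (forall i j, is_derive t 1 (fun s => M s i j) (M' i j)) ->
    (forall i j, is_derive t 1 (fun s => N s i j) (N' i j)) ->
  forall i j, is_derive t 1 (fun s => (M s *m N s) i j)
    ((M' *m N t + M t *m N') i j).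
Proof.
move=> DM DN i j; rewrite (_ : (fun s => _) =
  (fun s => \sum_k M s i k * N s k j)); last by apply/funext => s; rewrite mxE.
rewrite !mxE -big_split /=; apply: is_derive_bigsum => k.
have H := is_deriveM (DM i k) (DN k j).
by apply: is_derive_val H _; rewrite /GRing.scale /= addrC (mulrC (M' i k)).
Qed.

(** Differentiate [\tr (G^-1 *m H) = 0] with the help of
    [(G^-1)' = - G^-1 *m G' *m G^-1]. *)
Lemma trace_inv_derive {R : realType} {n : nat} (G H : R -> 'M[R]_n)
    (G' H' : 'M[R]_n) :
    (forall i j, is_derive (0 : R) 1 (fun t => G t i j) (G' i j)) ->
    (forall i j, is_derive (0 : R) 1 (fun t => H t i j) (H' i j)) ->
    (\forall t \near (0 : R), G t \in unitmx /\ \tr (invmx (G t) *m H t) = 0) ->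
  \tr (invmx (G 0) *m H') = \tr (invmx (G 0) *m G' *m invmx (G 0) *m H 0).
Proof.
move=> DG DH near0.
have uG : \forall t \near (0 : R), G t \in unitmx by apply: filterS near0 => t [].
have uG0 := nbhs_singleton uG.
pose Y' : 'M[R]_n := \matrix_(i, j) 'D_1 (fun s => invmx (G s) i j) (0 : R).
have DY i j : is_derive (0 : R) 1 (fun s => invmx (G s) i j) (Y' i j).
  rewrite mxE; apply: derivableP; apply: derivable_invmx uG _ _ => k l.
  by have [] := DG k l.
have E : Y' = - (invmx (G 0) *m G' *m invmx (G 0)).
  have : Y' *m G 0 + invmx (G 0) *m G' = 0.
    apply/matrixP => i j; rewrite [RHS]mxE.
    apply: is_derive_unique (is_derive_mulmx _ _ _ _ _ DY DG i j) _.
    apply: (@near_eq_is_derive _ _ _ (cst ((1%:M : 'M[R]_n) i j))).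
    by apply: filterS uG => t ut; rewrite mulVmx.
  move=> /eqP; rewrite addr_eq0 => /eqP E.
  by rewrite -(mulmxK uG0 Y') E mulNmx.
have : \tr (Y' *m H 0 + invmx (G 0) *m H') = 0.
  apply: (@is_derive_unique _ (fun t => \tr (invmx (G t) *m H t)) 0).
    rewrite /mxtrace; apply: is_derive_bigsum => i.
    exact: is_derive_mulmx.
  apply: (@near_eq_is_derive _ _ _ (cst 0)).
  by apply: filterS near0 => t [].
by rewrite E mulNmx mxtraceD linearN /= addrC => /eqP; rewrite subr_eq0 => /eqP.
Qed.

(** * Derivatives of solutions of the minimal surface system *)

Section GraphDerivatives.
Context {R : realType} {n m : nat}.
Implicit Types (f : 'rV[R]_n -> R) (u : 'rV[R]_n -> 'rV[R]_m) (x v e : 'rV[R]_n).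

Lemma gradE f x i : grad f x ord0 i = partial i f x.
Proof. by rewrite mxE. Qed.

Definition jac u x : 'M[R]_(n, m) :=
  \matrix_(i, b) partial i (component u b) x.

(** The derivative of the Jacobian in direction [v]; its product with [e] is
    [D^2 u (e, v)]. *)
Definition jac_dir u v x : 'M[R]_(n, m) :=
  \matrix_(i, b) dot v (grad (partial i (component u b)) x).

(** The second derivative of the Jacobian in direction [v]; its product with [e]
    is [D^3 u (e, v, v)]. *)
Definition jac_dir2 u v x : 'M[R]_(n, m) :=
  \matrix_(i, b) dot v (\row_p dot v (grad (partial p (partial i (component u b))) x)).

Definition hess f x : 'M[R]_n := \matrix_(i, j) partial j (partial i f) x.

Definition hess_dir f e x : 'M[R]_n :=
  \matrix_(i, j) dot e (grad (partial j (partial i f)) x).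

Lemma induced_metricE u x : induced_metric u x = graph_metric (jac u x).
Proof.
apply/matrixP => i j; rewrite !mxE; congr (_ + _).
by apply: eq_bigr => b _; rewrite !mxE.
Qed.

Context {D : set 'rV[R]_n} (oD : open D).

Lemma hess_tr {f x} : smooth_on D f -> D x -> (hess f x)^T = hess f x.
Proof.
move=> sf Dx; apply/matrixP => i j; rewrite !mxE.
exact: partial_comm oD sf Dx.
Qed.

Lemma third_comm {f x} (i p q : 'I_n) : smooth_on D f -> D x ->
  partial q (partial p (partial i f)) x = partial i (partial q (partial p f)) x.
Proof.
move=> sf Dx; have sp := smooth_partial p sf.
apply: etrans (partial_comm i q oD sp Dx).
apply: near_eq_derive; have ND : \forall y \near x, D y by apply: open_nbhs_nbhs.
by apply: filterS ND => y Dy; exact: partial_comm oD sf Dy.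
Qed.

Context {u : 'rV[R]_n -> 'rV[R]_m} (su : forall b, smooth_on D (component u b)).

Lemma jac_dirE {x} (z v : 'rV[R]_n) (b : 'I_m) : D x ->
  (z *m jac_dir u v x) ord0 b = dot (v *m hess (component u b) x) z.
Proof.
move=> Dx; rewrite -(hess_tr (su b) Dx) dotC mxE.
apply: eq_bigr => i _; rewrite !mxE; congr (_ * _).
by apply: eq_bigr => j _; rewrite !mxE.
Qed.

Lemma jac_dirC {x} (z v : 'rV[R]_n) : D x ->
  z *m jac_dir u v x = v *m jac_dir u z x.
Proof.
move=> Dx; apply/rowP => b; rewrite !jac_dirE // dot_mulmx hess_tr //.
exact: dotC.
Qed.

Lemma jac_dir2E {x} (e v : 'rV[R]_n) (b : 'I_m) : D x ->
  (e *m jac_dir2 u v x) ord0 b = dot (v *m hess_dir (component u b) e x) v.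
Proof.
move=> Dx; rewrite mxE /dot.
under eq_bigr do rewrite mxE /dot big_distrr /=.
rewrite exchange_big /=.
under [RHS]eq_bigr do rewrite mxE big_distrl /=.
rewrite [RHS]exchange_big /=; apply: eq_bigr => p _.
under eq_bigr do rewrite mxE /dot !big_distrr /=.
rewrite exchange_big /=; apply: eq_bigr => q _.
rewrite mxE /dot big_distrr big_distrl /=; apply: eq_bigr => i _.

rewrite [in LHS]gradE [in RHS]gradE.
have E := third_comm i p q (su b) Dx.
by apply: etrans (congr1 (fun c => _ * (_ * (_ * c))) E) _; ring.
Qed.


Lemma mss_trace {x} (b : 'I_m) : minimal_surface_system D u -> D x ->
  \tr (invmx (graph_metric (jac u x)) *m hess (component u b) x) = 0.
Proof.
move=> mss Dx; rewrite -(mss x Dx b) induced_metricE -(hess_tr (su b) Dx).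
apply: eq_bigr => i _; rewrite mxE; apply: eq_bigr => j _.
by rewrite !mxE.
Qed.

(** The system says that the trace of [g^-1] times each Hessian vanishes.  Its
    derivative expresses the third derivatives of [u] by second derivatives;
    the two terms of the derivative of [g] contribute equally because all the
    matrices involved are symmetric. *)
Lemma mss_derivative {x} e (b : 'I_m) : minimal_surface_system D u -> D x ->
  let X := invmx (graph_metric (jac u x)) in
  \tr (X *m hess_dir (component u b) e x) =
  2 * \tr (X *m jac_dir u e x *m (jac u x)^T *m X *m hess (component u b) x).
Proof.
move=> mss Dx X.
have DJ i c : is_derive (0 : R) 1 (fun t => jac u (t *: e + x) i c) (jac_dir u e x i c).
  rewrite (_ : (fun t => _) = (fun t => partial i (component u c) (t *: e + x))).
    rewrite mxE; apply: line_is_derive; rewrite scale0r add0r.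
    exact: (smooth_is_derive e oD (smooth_partial i (su c)) Dx).
  by apply/funext => t; rewrite mxE.
have DJT c i : is_derive (0 : R) 1 (fun t => (jac u (t *: e + x))^T c i)
    ((jac_dir u e x)^T c i).
  by rewrite [X in is_derive _ _ X](_ : _ = (fun t => jac u (t *: e + x) i c));
    [rewrite mxE|apply/funext => t; rewrite mxE].
have DG i j : is_derive (0 : R) 1 (fun t => graph_metric (jac u (t *: e + x)) i j)
  ((jac_dir u e x *m (jac u (0 *: e + x))^T +
    jac u (0 *: e + x) *m (jac_dir u e x)^T) i j).
  rewrite (_ : (fun t => _) = cst ((1%:M : 'M[R]_n) i j) +
     (fun t => (jac u (t *: e + x) *m (jac u (t *: e + x))^T) i j)).
    rewrite -[X in is_derive _ _ _ X]add0r; apply: is_deriveD.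
    exact: is_derive_mulmx.
  by apply/funext => t; rewrite /graph_metric mxE.
have DH i j : is_derive (0 : R) 1 (fun t => hess (component u b) (t *: e + x) i j)
    (hess_dir (component u b) e x i j).
  rewrite (_ : (fun t => _) =
      (fun t => partial j (partial i (component u b)) (t *: e + x))).
    rewrite mxE; apply: line_is_derive; rewrite scale0r add0r.
    apply: (smooth_is_derive e oD _ Dx).
    exact: (smooth_partial j (smooth_partial i (su b))).
  by apply/funext => t; rewrite mxE.
have := trace_inv_derive _ _ _ _ DG DH.
rewrite !scale0r !add0r -/X => ->; last first.
  have ND : \forall y \near x, D y by apply: open_nbhs_nbhs.
  apply: filterS (near_line e ND) => t Dt; split; first exact: graph_metric_unit.
  exact: mss_trace.
rewrite mulmxDr !mulmxDl mxtraceD mulr_natl mulr2n !mulmxA; congr (_ + _).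
rewrite -mxtrace_tr !trmx_mul trmxK hess_tr // inv_graph_metric_sym.
by rewrite -!mulmxA mxtrace_mulC -!mulmxA.
Qed.

End GraphDerivatives.

(** * First and second order conditions at the maximum *)

Lemma has_jet_sqnorm {R : realType} {p : nat} (f : 'I_p -> R -> R) (a b c : 'rV[R]_p) :
  (forall i, has_jet (f i) (a ord0 i) (b ord0 i) (c ord0 i)) ->
  has_jet (fun t => \sum_i f i t * f i t) (dot a a) (2 * dot a b)
    (2 * dot a c + 2 * dot b b).
Proof.
move=> Jf.
apply: has_jet_eq (has_jet_sum (fun i _ => has_jetM (Jf i) (Jf i))) _ _ _ _ => //.
  by rewrite /dot big_distrr; apply: eq_bigr => i _ /=; ring.
by rewrite /dot !big_distrr -big_split; apply: eq_bigr => i _ /=; ring.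
Qed.

Lemma has_jet_sqnorm_line {R : realType} {p : nat} (x v : 'rV[R]_p) :
  has_jet (fun t => dot (x + t *: v) (x + t *: v)) (dot x x) (2 * dot x v)
    (2 * dot v v).
Proof.
apply: has_jet_eq (has_jet_sqnorm (fun i t => x ord0 i + t * v ord0 i) x v 0 _)
  _ _ _ _ => //.
- by move=> i; rewrite mxE; exact: has_jet_affine.
- by move=> t; apply: eq_bigr => i _; rewrite !mxE.
- by rewrite dotC dot0l mulr0 add0r.
Qed.

(** The context [emax] says that [(f y)^(N + 2) (|z|^2 + |Du_y z|^2) / |z|^2] is
    maximal at [(y, z) = (x, e)], along all lines through that point.  The
    function [f] enters only through its jets along lines at [x]. *)
Section MaximumPoint.
Context {R : realType} {n m : nat} {D : set 'rV[R]_n} (oD : open D).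
Context {u : 'rV[R]_n -> 'rV[R]_m} (su : forall b, smooth_on D (component u b)).
Context {x : 'rV[R]_n} (Dx : D x).
Implicit Types v e z : 'rV[R]_n.

Lemma has_jet_graph_metric e v z :
  let A := jac u x in
  let w1 := e *m jac_dir u v x + z *m A in
  let w2 := e *m jac_dir2 u v x + 2 *: (z *m jac_dir u v x) in
  has_jet (fun t => dot (e + t *: z) (e + t *: z) +
      dot ((e + t *: z) *m jac u (t *: v + x)) ((e + t *: z) *m jac u (t *: v + x)))
    (dot e e + dot (e *m A) (e *m A))
    (2 * dot e z + 2 * dot (e *m A) w1)
    (2 * dot z z + (2 * dot (e *m A) w2 + 2 * dot w1 w1)).
Proof.
move=> A w1 w2; apply: has_jetD (has_jet_sqnorm_line e z) _.
apply: has_jet_sqnorm => b.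
have Ji i : has_jet (fun t => (e ord0 i + t * z ord0 i) *
    partial i (component u b) (t *: v + x)) _ _ _ :=
  has_jetM (has_jet_affine (e ord0 i) (z ord0 i))
    (has_jet_line v oD (smooth_partial i (su b)) Dx).
apply: has_jet_eq (has_jet_sum (fun i _ => Ji i)) _ _ _ _.
- by move=> t; rewrite mxE; apply: eq_bigr => i _; rewrite !mxE.
- by rewrite mxE; apply: eq_bigr => i _; rewrite mxE.
- by rewrite !mxE -big_split; apply: eq_bigr => i _; rewrite !mxE.
- rewrite !mxE big_distrr -big_split; apply: eq_bigr => i _; rewrite !mxE /=; ring.
Qed.

Context {f : 'rV[R]_n -> R} {f0 : R} {f1 f2 : 'rV[R]_n -> R} (N : nat).
Context (f_gt0 : 0 < f0) (f10 : f1 0 = 0).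
Context (Jf : forall v, has_jet (fun t => f (t *: v + x)) f0 (f1 v) (f2 v)).
Context {e : 'rV[R]_n} (e1 : dot e e = 1).
Local Notation A := (jac u x).
Local Notation L := (dot (e *m A) (e *m A)).
Context (emax : forall v z, \forall t \near (0 : R),
  f (t *: v + x) ^+ N.+2 * (dot (e + t *: z) (e + t *: z) +
    dot ((e + t *: z) *m jac u (t *: v + x)) ((e + t *: z) *m jac u (t *: v + x)))
  <= f0 ^+ N.+2 * (1 + L) * dot (e + t *: z) (e + t *: z)).

(** Moving the base point along [v] and the test vector along [z] gives a function
    of one variable that is at most [0] and vanishes at [0]; [has_jet_max]
    applies to it. *)
Lemma max_point_jet v z :
  let p1 := N.+2%:R * f0 ^+ N.+1 * f1 v in
  let p2 := N.+2%:R * (N.+1%:R * f0 ^+ N * f1 v ^+ 2 + f0 ^+ N.+1 * f2 v) in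
  let H := e *m jac_dir u v x in
  let T := e *m jac_dir2 u v x in
  let y := e *m A in
  let q1 := dot e z + (dot y H + dot y (z *m A)) in
  let q2 := dot z z + (dot y T + 2 * dot y (z *m jac_dir u v x) +
     (dot H H + 2 * dot H (z *m A) + dot (z *m A) (z *m A))) in
  f0 ^+ N.+2 * (2 * q1) + p1 * (1 + L) - f0 ^+ N.+2 * (1 + L) * (2 * dot e z) = 0 /\
  f0 ^+ N.+2 * (2 * q2) + 2 * (p1 * (2 * q1)) + p2 * (1 + L)
    - f0 ^+ N.+2 * (1 + L) * (2 * dot z z) <= 0.
Proof.
move=> p1 p2 H T y q1 q2.
have JF := has_jetM (has_jetX N (Jf v)) (has_jet_graph_metric e v z).
have JE := has_jet_sqnorm_line e z.
have JJ := has_jetD JF (has_jetZ (- (f0 ^+ N.+2 * (1 + L))) JE).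
apply: has_jet_max; first apply: has_jet_eq JJ _ _ _ _.
- by move=> t; reflexivity.
- by rewrite e1; ring.
- by rewrite /q1 /p1 e1 !dotE -/y -/H; ring.
- by rewrite /q2 /q1 /p1 /p2 e1 !dotE -/y -/H -/T (dotC (z *m A) H); ring.
by apply: filterS (emax v z) => t; rewrite mulNr subr_le0.
Qed.

(** Only the test vector is moved ([v = 0]): a maximiser of the Rayleigh quotient
    is an eigenvector. *)
Lemma max_point_eigen z : dot (z *m A) (e *m A) = L * dot z e.
Proof.
have [+ _] := max_point_jet 0 z.
have -> : jac_dir u 0 x = 0 by apply/matrixP => i b; rewrite !mxE dot0l.
rewrite mulmx0 f10 (dotC _ 0) dot0l mulr0 mul0r addr0 add0r.
have p0 : f0 ^+ N.+2 != 0 by rewrite expf_neq0 // gt_eqF.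
move=> /eqP; rewrite subr_eq0 -mulrA => /eqP /(mulfI p0).
rewrite (dotC z e) (dotC (z *m A)); lra.
Qed.

Context (L0 : 0 < L).
Context (area : forall z, dot z e = 0 -> L * dot (z *m A) (z *m A) <= dot z z).

Local Notation hess_covector v :=
  (\sum_b (e *m A) ord0 b *: (v *m hess (component u b) x)).

(** The second order condition with the rotation speed [z] of [key_ineq]; the
    first order condition eliminates [s = <e A, D^2 u (e, v)>] in favour of the
    derivative of [f].  The term that is left over, with third derivatives of
    [u], cancels only after summation over the frame. *)
Lemma max_point_direction v :
  N.+2%:R * (1 + L) * (N%:R / 2 * f1 v ^+ 2 + f0 * f2 v) +
  f0 ^+ 2 * (2 * dot (e *m A) (e *m jac_dir2 u v x) -
     4 * dot (e *m jac_dir u v x)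
       (hess_covector v *m invmx (graph_metric A) *m A)) <= 0.
Proof.
have L1 : 0 < 1 + L by rewrite addr_gt0.
set H := e *m jac_dir u v x; set y := e *m A; set B := \sum_b _.
have By z : dot B z = dot y (z *m jac_dir u v x).
  rewrite dotC dot_sumr [RHS]/dot; apply: eq_bigr => b _.
  by rewrite dotZr (dotC z) (jac_dirE oD su z v b Dx).
pose s := dot y H.
have Be : dot B e = s by rewrite By.
have Hs : dot H (e *m A) = s by rewrite dotC.
have [z ze key] := key_ineq L0 e1 max_point_eigen area B H s Be Hs.
have [J1 J2] := max_point_jet v z.
have yz : dot y (z *m A) = 0 by rewrite dotC max_point_eigen ze mulr0.
move: J1 J2 key; rewrite By (dotC e z) ze yz -/H -/y -/s (dotC (z *m A) H).
move: (dot y (e *m jac_dir2 u v x)) (dot H (B *m _ *m A)) (dot z z) => a b c.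
move: (dot y (z *m _)) (dot H (z *m A)) (dot (z *m A) (z *m A)) (dot H H).
move: L1; rewrite -/y; move: (dot y y) => l0 L1.
clear Be Hs; clearbody s.
move: (f1 v) (f2 v) => g1 g2 d h k l J1 J2 key.
pose F := f0 ^+ N; have F0 : 0 < F by rewrite exprn_gt0.
move: J1 J2; rewrite (exprSr f0 N.+1) (exprSr f0 N) -/F => J1 J2.
pose r := s / (1 + l0); have sr : s = r * (1 + l0) by rewrite /r divfK // gt_eqF.
have r1 : 2 * f0 * r = - (N.+2%:R * g1).
  apply: (mulfI (lt0r_neq0 (mulr_gt0 (mulr_gt0 F0 f_gt0) L1))).
  by move: J1; rewrite sr => J1; lra.
have r2 : 4 * (f0 ^+ 2 * r ^+ 2) = N.+2%:R ^+ 2 * g1 ^+ 2.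
  by transitivity ((2 * f0 * r) ^+ 2); [ring|rewrite r1; ring].
have r3 : 2 * (N.+2%:R * f0 * g1 * r) = - (N.+2%:R ^+ 2 * g1 ^+ 2).
  by transitivity (N.+2%:R * g1 * (2 * f0 * r)); [ring|rewrite r1; ring].
have {}r2 := congr1 ( *%R (F * (1 + l0))) r2.
have {}r3 := congr1 ( *%R (F * (1 + l0))) r3.
have s2 : 6 / (1 + l0) * s ^+ 2 = 6 * r ^+ 2 * (1 + l0).
  by rewrite sr; field; rewrite gt_eqF.
rewrite s2 -subr_le0 in key.
have {}key := mulr_ge0_le0 (ltW (mulr_gt0 F0 (mulr_gt0 f_gt0 f_gt0))) key.
rewrite sr in J2.
have KN1 : N.+1%:R = N.+2%:R - 1 :> R by rewrite -(natr1 N.+1) addrK.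
have KN : N%:R = N.+2%:R - 2 :> R by rewrite -(natr1 N.+1) -(natr1 N); ring.
move: J2; rewrite KN1 KN; move: (N.+2%:R : R) r2 r3 => K r2 r3 J2.
rewrite -(pmulr_rle0 _ F0).
have S := lerD J2 key; rewrite (addr0 0) in S; apply: (le_trans _ S).
rewrite /= in r2 r3; lra.
Qed.

(** In coordinates, [g^ij (N / 2 f_i f_j + f f_ij) <= 0].  The third derivatives
    of [u] disappear by the differentiated system [mss_derivative]. *)
Lemma max_point_inequality : minimal_surface_system D u ->
  \sum_k (N%:R / 2 * f1 (row k (frame A)) ^+ 2 + f0 * f2 (row k (frame A))) <= 0.
Proof.
move=> mss /=; set V := frame A; pose y := e *m A; set X := invmx (graph_metric A).
have L1 : 0 < 1 + L by rewrite addr_gt0.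
pose hy := \sum_b y ord0 b *: hess (component u b) x.
have BE v : hess_covector v = v *m hy.
  by rewrite /hy mulmx_sumr; apply: eq_bigr => b _; rewrite scalemxAr.
have hyT : hy^T = hy.
  rewrite /hy linear_sum; apply: eq_bigr => b _ /=.
  by rewrite linearZ /= (hess_tr oD (su b) Dx).
pose W := jac_dir u e x.
have third : \sum_k dot y (e *m jac_dir2 u (row k V) x) =
    \sum_b y ord0 b * \tr (X *m hess_dir (component u b) e x).
  rewrite /dot exchange_big; apply: eq_bigr => b _ /=.
  rewrite -big_distrr /=; congr (_ * _).
  rewrite -[hess_dir _ _ _]mulmx1 -trmx1 -frame_sum; apply: eq_bigr => k _.
  by rewrite (jac_dir2E oD su e (row k V) b Dx) mulmx1.
have first : \sum_k dot (e *m jac_dir u (row k V) x) (hess_covector (row k V) *m X *m A)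
   = \tr (X *m W *m A^T *m X *m hy).
  under eq_bigr do rewrite BE (jac_dirC oD su _ _ Dx) -/W -(mulmxA _ hy) -mulmxA.
  rewrite frame_sum -/X !trmx_mul hyT inv_graph_metric_sym -/X.
  by rewrite !mulmxA.
have cancel : 2 * (\sum_k dot y (e *m jac_dir2 u (row k V) x)) -
    4 * (\sum_k dot (e *m jac_dir u (row k V) x) (hess_covector (row k V) *m X *m A)) = 0.
  rewrite third first /hy mulmx_sumr raddf_sum /= !big_distrr -sumrB /=.
  apply: big1 => b _; rewrite (mss_derivative oD su e b mss Dx) -/X -/W.
  by rewrite -scalemxAr mxtraceZ; ring.
have S : \sum_k (N.+2%:R * (1 + L) * (N%:R / 2 * f1 (row k V) ^+ 2 + f0 * f2 (row k V)) +
  f0 ^+ 2 * (2 * dot y (e *m jac_dir2 u (row k V) x) -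
     4 * dot (e *m jac_dir u (row k V) x) (hess_covector (row k V) *m X *m A))) <= 0.
  by apply: sumr_le0 => k _; exact: max_point_direction.
move: S; rewrite big_split -!big_distrr /= sumrB -!big_distrr /= cancel mulr0 addr0.
by rewrite pmulr_rle0 // mulr_gt0.
Qed.

End MaximumPoint.

(** * The cutoff function *)

Section Cutoff.
Context {R : realType} {n m : nat} {D : set 'rV[R]_n} (oD : open D).
Context (u : 'rV[R]_n -> 'rV[R]_m) (su : forall b, smooth_on D (component u b)).
Context (b0 : 'I_m) (a c : R).

(** Here [b0] is the index of [u^1].  When [u^1 >= 0] and the other components are
    small, this function is positive only well inside the unit ball, and it is
    at least [1 / 4] at the origin if [a u^1 (0) <= 1 / 2].  The linear term in
    [u^1] makes its gradient large where [u^1] is steep; the quadratic term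
    makes it strictly subharmonic where one of the other components is steep. *)
Definition cutoff (x : 'rV[R]_n) : R :=
  3 / 4 - dot x x - a * component u b0 x +
  c * \sum_(b | b != b0) component u b x ^+ 2.

(** First derivative of [cutoff] at [x] in direction [v]. *)
Definition cutoff1 (x v : 'rV[R]_n) : R :=
  - (2 * dot x v) - a * (v *m jac u x) ord0 b0 +
  2 * c * \sum_(b | b != b0) component u b x * (v *m jac u x) ord0 b.

(** Second derivative of [cutoff] at [x] in direction [v]. *)
Definition cutoff2 (x v : 'rV[R]_n) : R :=
  - (2 * dot v v) - a * dot (v *m hess (component u b0) x) v +
  2 * c * \sum_(b | b != b0) ((v *m jac u x) ord0 b ^+ 2 +
     component u b x * dot (v *m hess (component u b) x) v).

Lemma cutoff10 x : cutoff1 x 0 = 0.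
Proof.
rewrite /cutoff1 mul0mx dotC dot0l mxE !mulr0 !oppr0 !add0r big1 ?mulr0 // => b _.
by rewrite mxE mulr0.
Qed.

Lemma has_jet_cutoff {x} v : D x ->
  has_jet (fun t => cutoff (t *: v + x)) (cutoff x) (cutoff1 x v) (cutoff2 x v).
Proof.
move=> Dx.
have Jx : has_jet (fun t => dot (t *: v + x) (t *: v + x)) (dot x x) (2 * dot x v)
    (2 * dot v v).
  by apply: has_jet_eq (has_jet_sqnorm_line x v) _ _ _ _ => // t; rewrite addrC.
have Ju b : has_jet (fun t => component u b (t *: v + x)) (component u b x)
    ((v *m jac u x) ord0 b) (dot (v *m hess (component u b) x) v).
  apply: has_jet_eq (has_jet_line v oD (su b) Dx) _ _ _ _ => //.
    by rewrite mxE; apply: eq_bigr => i _; rewrite !mxE.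
  rewrite dot_mulmx; congr dot; apply/rowP => i; rewrite !mxE.
  by apply: eq_bigr => j _; rewrite !mxE.
have Jq := has_jet_sum (r := index_enum _) (P := fun b => b != b0)
  (fun b _ => has_jetM (Ju b) (Ju b)).
apply: has_jet_eq (has_jetD (has_jetD (has_jetD (has_jet_cst (3 / 4)) (has_jetZ (-1) Jx))
   (has_jetZ (- a) (Ju b0))) (has_jetZ c Jq)) _ _ _ _.
- move=> t; rewrite /cutoff; under [in RHS]eq_bigr do rewrite expr2.
  by rewrite mulN1r mulNr.
- rewrite /cutoff; under [in RHS]eq_bigr do rewrite expr2.
  by rewrite mulN1r mulNr.
- rewrite /cutoff1 (mulrC 2 c) -[in RHS]mulrA.
  rewrite [X in _ = _ + c * X]big_distrr /= mulN1r mulNr add0r.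
  by congr (_ + c * _); apply: eq_bigr => b _; ring.
- rewrite /cutoff2 (mulrC 2 c) -[in RHS]mulrA.
  rewrite [X in _ = _ + c * X]big_distrr /= mulN1r mulNr add0r.
  by congr (_ + c * _); apply: eq_bigr => b _; ring.
Qed.

Context {x : 'rV[R]_n} (Dx : D x).
Local Notation A := (jac u x).
Local Notation V := (frame A).

(** The components of [u] are harmonic for the induced metric, so that only the
    second derivatives of the squares survive in the trace. *)
Lemma sum_cutoff2 : minimal_surface_system D u ->
  \sum_k cutoff2 x (row k V) =
  - (2 * \sum_k dot (row k V) (row k V)) +
  2 * c * \sum_k \sum_(b | b != b0) (row k V *m A) ord0 b ^+ 2.
Proof.
move=> mss.
have r0 b : \sum_k dot (row k V *m hess (component u b) x) (row k V) = 0.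
  transitivity (\tr (invmx (graph_metric A) *m (hess (component u b) x *m 1%:M^T))).
    by rewrite -frame_sum; apply: eq_bigr => k _; rewrite mulmx1.
  by rewrite trmx1 mulmx1 (mss_trace oD su b mss Dx).
rewrite /cutoff2 big_split sumrB sumrN -!big_distrr /= r0 mulr0 subr0; congr (_ + _ * _).
under eq_bigr do rewrite big_split /=.
rewrite big_split /= -[RHS]addr0; congr (_ + _).
rewrite exchange_big big1 // => b _.
by rewrite -big_distrr /= r0 mulr0.
Qed.

End Cutoff.

(** * A maximum point cannot have a large gradient *)

(** Throughout, [E1] is the energy density of the component [b0] in the induced
    metric and [E2] that of all the other components. *)
Section LargeGradient.
Context {R : realType} {n m : nat} {D : set 'rV[R]_n} (oD : open D).
Context {u : 'rV[R]_n -> 'rV[R]_m} (su : forall b, smooth_on D (component u b)).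
Context (mss : minimal_surface_system D u).
Context (b0 : 'I_m) {a c : R} (a0 : 0 < a) (c_def : c = 4 * n%:R + 4).
Context {x : 'rV[R]_n} (Dx : D x) (x1 : dot x x <= 1).
Local Notation A := (jac u x).
Local Notation V := (frame A).
Context {d : R} (ud : \sum_(b | b != b0) component u b x ^+ 2 <= d)
  (d_small : 64 * c ^+ 2 * n%:R * d <= a ^+ 2).
Context {e : 'rV[R]_n} (e1 : dot e e = 1).
Local Notation L := (dot (e *m A) (e *m A)).
Context (eig : forall z, dot (z *m A) (e *m A) = L * dot z e).
Context (area : forall z, dot z e = 0 ->
  L * dot (z *m A) (z *m A) <= dot z z).
Context (L_large : 3 + (32 / a) ^+ 2 <= L).

Local Notation E1 := (\sum_k (row k V *m A) ord0 b0 ^+ 2).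
Local Notation E2 := (\sum_k \sum_(b | b != b0) (row k V *m A) ord0 b ^+ 2).

Let a20 : 0 < a ^+ 2. Proof. by rewrite exprn_gt0. Qed.

Let L3 : 3 <= L.
Proof.
have H := sqr_ge0 (32 / a).
by move: L_large; move: L => l; lra.
Qed.

Let L0 : 0 < L. Proof. by move: L3; move: L => l; lra. Qed.

Let energy_split : \sum_k dot (row k V *m A) (row k V *m A) = E1 + E2.
Proof.
rewrite -big_split; apply: eq_bigr => k _.
by rewrite /dot (bigD1 b0) //= expr2; congr (_ + _); apply: eq_bigr => b _; rewrite expr2.
Qed.

Let energy_le : E1 + E2 <= n%:R.
Proof.
rewrite -energy_split -(frame_energy A) lerDr.
by apply: sumr_ge0 => k _; exact: dot_ge0.
Qed.

Let energy_ge : 3 / 4 <= E1 + E2.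
Proof.
rewrite -energy_split; apply: le_trans (frame_energy_ge L0 e1 eig).
rewrite ler_pdivlMr ?addr_gt0 //; have := L3; lra.
Qed.

Let frame_norm_le : \sum_k dot (row k V) (row k V) <= n%:R.
Proof.
rewrite -(frame_energy A) lerDl.
by apply: sumr_ge0 => k _; exact: dot_ge0.
Qed.

(** The inner product of the gradients of [u^b0] and of [|x|^2 / 2] in the induced
    metric, which is a coordinate of [x *m g^-1 *m A]. *)
Lemma cross_term_small :
  - (a / 16) <= \sum_k (row k V *m A) ord0 b0 * dot x (row k V) <= a / 16.
Proof.
have -> : \sum_k (row k V *m A) ord0 b0 * dot x (row k V) =
    (x *m invmx (graph_metric A) *m A) ord0 b0.
  have H (v : 'rV[R]_n) : (v *m A) ord0 b0 = dot v (row b0 A^T).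
    by rewrite mxE; apply: eq_bigr => i _; rewrite !mxE.
  rewrite H -frame_dot_sum; apply: eq_bigr => k _.
  by rewrite H mulrC (dotC x).
have := coord_sqr_le_dot (x *m invmx (graph_metric A) *m A) b0.
move=> /le_trans /(_ (cross_bound L0 e1 eig area x x1)).
move: (_ ord0 b0) => w w4.
have : w ^+ 2 <= (a / 16) ^+ 2.
  have H : (32 / a) ^+ 2 <= L by move: L_large; move: L => l; lra.
  apply: le_trans w4 _; rewrite ler_pdivrMr //.
  apply: le_trans (_ : (a / 16) ^+ 2 * (32 / a) ^+ 2 <= _).
    by rewrite -exprMn (_ : a / 16 * (32 / a) = 2); [lra|field; rewrite gt_eqF].
  by rewrite ler_wpM2l // sqr_ge0.
have a16 : 0 <= a / 16 by rewrite divr_ge0 // ltW.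
by move: (a / 16) a16 => r r0 wr; apply/andP; split; nra.
Qed.

(** If the components other than [b0] carry little energy, then [u^b0] carries
    at least [1 / 2], and the gradient of [cutoff] is dominated by
    [- a * grad u^b0]: by [cross_term_small] the gradient of [|x|^2] is almost
    orthogonal to it, and the gradient of the quadratic term is small because
    the components themselves are. *)
Lemma gradient_cutoff_ge : E2 < 1 / 4 ->
  a ^+ 2 / 16 <= \sum_k cutoff1 u b0 a c x (row k V) ^+ 2.
Proof.
move=> E2s.
pose al k := - a * (row k V *m A) ord0 b0.
pose be k := - (2 * dot x (row k V)).
pose ga k := 2 * c * \sum_(b | b != b0) component u b x * (row k V *m A) ord0 b.
have gamma2 k : ga k ^+ 2 <= 4 * c ^+ 2 * d *
    dot (row k V *m A) (row k V *m A).
  pose w : 'rV[R]_m := \row_b (if b != b0 then component u b x else 0).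
  have -> : ga k = 2 * c * dot w (row k V *m A).
    rewrite /ga big_mkcond; congr (_ * _); apply: eq_bigr => b _.
    by rewrite [w ord0 b]mxE; case: ifP; rewrite ?mul0r.
  have wd : dot w w <= d.
    rewrite (_ : dot w w = \sum_(b | b != b0) component u b x ^+ 2) // big_mkcond.
    by apply: eq_bigr => b _; rewrite [w ord0 b]mxE; case: ifP; rewrite ?mul0r // expr2.
  have := dot_cauchy w (row k V *m A); have := dot_ge0 (row k V *m A).
  move: (dot _ (row k V *m A)) (dot _ (row k V *m A)) => p q q0 pq.
  rewrite exprMn (_ : (2 * c) ^+ 2 = 4 * c ^+ 2); last by ring.
  have c20 : 0 <= 4 * c ^+ 2 by have := sqr_ge0 c; lra.
  rewrite -[leRHS]mulrA ler_wpM2l //.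
  by apply: le_trans pq _; rewrite ler_wpM2r.
have d0 : 0 <= d by apply: le_trans ud; apply: sumr_ge0 => b _; exact: sqr_ge0.
have gsum : \sum_k ga k ^+ 2 <= a ^+ 2 / 16.
  apply: le_trans (ler_sum _ (fun k _ => gamma2 k)) _.
  rewrite -big_distrr /= energy_split.
  apply: le_trans (_ : _ <= 4 * c ^+ 2 * d * n%:R) _.
    by rewrite ler_wpM2l // mulr_ge0 //; have := sqr_ge0 c; lra.
  rewrite ler_pdivlMr //; apply: le_trans d_small.
  by rewrite le_eqVlt; apply/orP; left; apply/eqP; ring.
have sq k : al k ^+ 2 / 2 + al k * be k - ga k ^+ 2 <=
    cutoff1 u b0 a c x (row k V) ^+ 2.
  have -> : cutoff1 u b0 a c x (row k V) = al k + be k + ga k.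
    by rewrite /cutoff1 /al /be /ga; ring.
  have := sqr_ge0 (al k + be k + 2 * ga k); have := sqr_ge0 (be k).
  move: (al k) (be k) (ga k) => p q r; nra.
apply: le_trans (ler_sum _ (fun k _ => sq k)).
rewrite sumrB big_split /=.
have -> : \sum_k al k ^+ 2 / 2 = a ^+ 2 / 2 * E1.
  by rewrite big_distrr; apply: eq_bigr => k _; rewrite /al /=; ring.
have -> : \sum_k al k * be k = 2 * a *
    \sum_k (row k V *m A) ord0 b0 * dot x (row k V).
  by rewrite big_distrr; apply: eq_bigr => k _; rewrite /al /be /=; ring.
have /andP[lo _] := cross_term_small.
have E1h : 1 / 2 <= E1 by have := energy_ge; lra.
have H1 : a ^+ 2 / 2 * (1 / 2) <= a ^+ 2 / 2 * E1 by rewrite ler_wpM2l // divr_ge0 // ltW.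
have H2 : 2 * a * (- (a / 16)) <= 2 * a *
    \sum_k (row k V *m A) ord0 b0 * dot x (row k V).
  by rewrite ler_wpM2l // mulr_ge0 // ltW.
move: gsum H1 H2; rewrite expr2; lra.
Qed.

(** If the components other than [b0] carry energy, then the Laplacian of
    [cutoff] is positive by the choice of [c]; otherwise its gradient is bounded
    below, and a large [N] makes the gradient term win. *)
Lemma large_gradient_absurd (N : nat) (f0 : R) : 0 < f0 -> f0 <= 1 ->
    64 * n%:R < N%:R * a ^+ 2 ->
  0 < \sum_k (N%:R / 2 * cutoff1 u b0 a c x (row k V) ^+ 2 +
              f0 * cutoff2 u b0 a c x (row k V)).
Proof.
move=> f00 f01 NB.
rewrite big_split -!big_distrr /= (sum_cutoff2 oD u su b0 a c Dx mss).
set S0 := \sum_k dot _ _.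
have S0n : S0 <= n%:R by exact: frame_norm_le.
set S1 := \sum_k cutoff1 _ _ _ _ _ _ ^+ 2.
have S10 : 0 <= S1 by apply: sumr_ge0 => k _; exact: sqr_ge0.
have n0 : 0 <= n%:R :> R by exact: ler0n.
have N0 : 0 <= N%:R :> R by exact: ler0n.
have E20 : 0 <= E2.
  by apply: sumr_ge0 => k _; apply: sumr_ge0 => b _; exact: sqr_ge0.
have c0 : 0 < c by rewrite c_def; lra.
have [E2l|E2s] := lerP (1 / 4) E2.
  apply: ltr_wpDl; first by rewrite mulr_ge0 // divr_ge0.
  rewrite mulr_gt0 //.
  have : 2 * c * (1 / 4) <= 2 * c * E2 by rewrite ler_wpM2l // mulr_ge0 // ltW.
  by move: S0n n0; rewrite c_def; lra.
have S1l := gradient_cutoff_ge E2s; rewrite -/S1 in S1l.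
have H1 : N%:R / 2 * (a ^+ 2 / 16) <= N%:R / 2 * S1.
  by rewrite ler_wpM2l // divr_ge0.
have H2 : f0 * (- (2 * n%:R)) <= f0 * (- (2 * S0) + 2 * c * E2).
  rewrite ler_pM2l //; have : 0 <= 2 * c * E2 by rewrite !mulr_ge0 // ltW.
  by move: S0n; lra.
have H3 : f0 * n%:R <= n%:R by rewrite ler_piMl.
move: H1 H2 H3 NB; lra.
Qed.

End LargeGradient.

(** * The unit ball, the Jacobian and the area-decreasing condition *)

Section Domain.
Context {R : realType}.

Lemma dot_continuous {n : nat} : continuous (fun x : 'rV[R]_n => dot x x).
Proof.
move=> x; rewrite /dot; apply: (@cvg_bigsum _ _ _ _ _ (nbhs x)) => i _.
by apply: cvgM; exact: coord_continuous.
Qed.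

Lemma enorm_rV {n : nat} (x : 'rV[R]_n) : enorm x = Num.sqrt (dot x x).
Proof.
by rewrite /enorm big_ord1; congr Num.sqrt.
Qed.

Lemma unit_ballE {n : nat} (x : 'rV[R]_n) : unit_ball R n x <-> dot x x < 1.
Proof.
by rewrite /unit_ball /= enorm_rV -[X in Num.sqrt _ < X]sqrtr1 ltr_sqrt.
Qed.

Lemma unit_ball_open {n : nat} : open (unit_ball R n).
Proof.
rewrite (_ : unit_ball R n = (fun x => dot x x) @^-1` [set y | y < 1]).
  by apply: open_comp => [x _|]; [exact: dot_continuous|exact: open_lt].
by apply/seteqP; split => x /unit_ballE.
Qed.

Lemma dot_ball_compact {n : nat} (r : R) :
  compact [set x : 'rV[R]_n | dot x x <= r].
Proof.
apply: bounded_closed_compact.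
  exists (r + 1); split; first exact: num_real.
  move=> M rM x /= xr; have r0 := le_trans (dot_ge0 x) xr.
  have M0 : 0 <= M by lra.
  apply: rV_norm_le => // i; have := le_trans (coord_sqr_le_dot x i) xr.
  rewrite -real_normK ?num_real //; have := normr_ge0 (x ord0 i); nra.
rewrite (_ : mkset _ = (fun x => dot x x) @^-1` [set y | y <= r]) //.
by apply: preimage_closed => [x _|]; [exact: dot_continuous|exact: closed_le].
Qed.

Lemma dot_sphere_compact {n : nat} :
  compact [set x : 'rV[R]_n | dot x x = 1].
Proof.
apply: (subclosed_compact _ (dot_ball_compact (n := n) 1)); last first.
  by move=> x /= ->.
rewrite (_ : mkset _ = (fun x => dot x x) @^-1` [set y | y = 1]) //.
by apply: preimage_closed => [x _|]; [exact: dot_continuous|exact: closed_eq].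
Qed.

End Domain.

Section Jacobian.
Context {R : realType} {n m : nat} {D : set 'rV[R]_n} (oD : open D).
Context {u : 'rV[R]_n -> 'rV[R]_m} (su : forall b, smooth_on D (component u b)).

Lemma jacobianE {x : 'rV[R]_n} : D x -> 'J u x = jac u x.
Proof.
move=> Dx.
have du : differentiable u x.
  rewrite (_ : u = \sum_(b < m)
      (fun y => component u b y *: (delta_mx ord0 b : 'rV[R]_m))).
    apply: differentiable_sum => b; apply: differentiableZl.
    by have [] := smooth_is_diff oD (su b) Dx.
  apply/funext => y; rewrite fct_sumE [LHS]row_sum_delta.
  by apply: eq_bigr.
apply/row_matrixP => i; rewrite rowE -deriveEjacobian // derive_mx; last first.
  exact: diff_derivable.
by apply/rowP => b; rewrite !mxE.
Qed.

(** The Gram matrix of the images of [e] and [z / |z|] is diagonal, because [e] is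
    an eigenvector, and its determinant is the product of the squared lengths. *)
Lemma area_decreasing_dot {x e : 'rV[R]_n} : area_decreasing D u -> D x ->
    dot e e = 1 ->
    (forall z, dot (z *m jac u x) (e *m jac u x) =
       dot (e *m jac u x) (e *m jac u x) * dot z e) ->
  forall z, dot z e = 0 ->
    dot (e *m jac u x) (e *m jac u x) * dot (z *m jac u x) (z *m jac u x) <= dot z z.
Proof.
move=> ad Dx e1 eig z ze; set A := jac u x in eig *.
have [z0|z0] := eqVneq (dot z z) 0.
  by rewrite (dot_eq0 z0) mul0mx !dot0l mulr0.
have zp : 0 < dot z z by rewrite lt_neqAle eq_sym z0 dot_ge0.
pose s := Num.sqrt (dot z z).
have s0 : 0 < s by rewrite sqrtr_gt0.
have s2 : s ^+ 2 = dot z z by rewrite sqr_sqrtr // ltW.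
pose w := s^-1 *: z.
have ww : dot w w = 1.
  by rewrite /w !dotE mulrA -expr2 exprVn s2 mulVf.
have we : dot w e = 0 by rewrite /w !dotE ze mulr0.
pose V : 'M[R]_(2, n) := \matrix_i (if i == ord0 then e else w).
have gram p (P : 'M[R]_(2, p)) i j : (P *m P^T) i j = dot (row i P) (row j P).
  by rewrite mxE; apply: eq_bigr => k _; rewrite !mxE.
have VV : V *m V^T = 1%:M.
  apply/matrixP => i j; rewrite gram !rowK !mxE.
  by case: i j => [[|[|//]] ?] [[|[|//]] ?] /=; rewrite ?e1 ?ww ?we // dotC we.
have wA : dot (w *m A) (e *m A) = 0 by rewrite eig we mulr0.
have := ad x Dx V VV; rewrite /plane_jacobian (jacobianE Dx) -/A.
have -> : \det (V *m A *m (V *m A)^T) =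
    dot (e *m A) (e *m A) * dot (w *m A) (w *m A).
  rewrite det_trig; last first.
    apply/is_trig_mxP => i j ij; rewrite gram !row_mul !rowK.
    by move: ij; case: i j => [[|[|//]] ?] [[|[|//]] ?] //= _; rewrite dotC wA.
  by rewrite big_ord_recl big_ord1 !gram !row_mul !rowK.
rewrite -[X in _ <= X -> _]sqrtr1 ler_sqrt // /w -scalemxAl !dotE.
move=> H; rewrite -s2; move: H.
have -> : dot (e *m A) (e *m A) * (s^-1 * (s^-1 * dot (z *m A) (z *m A))) =
   (dot (e *m A) (e *m A) * dot (z *m A) (z *m A)) / s ^+ 2.
  by field; rewrite gt_eqF.
by rewrite ler_pdivrMr ?exprn_gt0 // mul1r.
Qed.

End Jacobian.

(** * The quantity to be maximised *)

Section CutoffEnergy.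
Context {R : realType} {n m : nat}.
Local Notation D := (unit_ball R n).
Context {u : 'rV[R]_n -> 'rV[R]_m} (su : forall b, smooth_on D (component u b)).
Context (b0 : 'I_m) (a c : R).
Local Notation phi := (cutoff u b0 a c).

Lemma cutoff_continuous {x} : D x -> {for x, continuous phi}.
Proof.
move=> Dx; have cu b := smooth_continuous (su b) Dx.
have cs : {for x, continuous (fun y => \sum_(b | b != b0) component u b y ^+ 2)}.
  apply: (@cvg_bigsum _ _ _ _ _ (nbhs x)) => b _.
  exact: (continuousM (cu b) (cu b)).
have ck (k : R) : {for x, continuous (fun _ : 'rV[R]_n => k)} by exact: cst_continuous.
exact: (continuousD (continuousB (continuousB (ck _) (@dot_continuous R n x))
  (continuousM (ck a) (cu b0))) (continuousM (ck c) cs)).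
Qed.

(** Truncating the cutoff at [0] keeps points with negative cutoff from competing
    when the exponent is even. *)
Definition cutoff_energy (N : nat) (p : 'rV[R]_n * 'rV[R]_n) : R :=
  Num.max (phi p.1) 0 ^+ N *
  (dot p.2 p.2 + dot (p.2 *m jac u p.1) (p.2 *m jac u p.1)).

Lemma cutoff_energy_continuous N p : D p.1 ->
  {for p, continuous (cutoff_energy N)}.
Proof.
move=> Dp.
have c1 (f : 'rV[R]_n -> R) : {for p.1, continuous f} ->
    {for p, continuous (fun q : 'rV[R]_n * 'rV[R]_n => f q.1)}.
  move=> cf; apply: (@cvg_comp _ _ _ fst f) cf; exact: cvg_fst.
have c2 (f : 'rV[R]_n -> R) : {for p.2, continuous f} ->
    {for p, continuous (fun q : 'rV[R]_n * 'rV[R]_n => f q.2)}.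
  move=> cf; apply: (@cvg_comp _ _ _ snd f) cf; exact: cvg_snd.
apply: continuousM.
  apply: (@cvg_comp _ _ _ (fun q : 'rV[R]_n * 'rV[R]_n => Num.max (phi q.1) 0)
    (fun y => y ^+ N)); last exact: exprn_continuous.
  apply: (@continuous_max _ _ (fun q : 'rV[R]_n * 'rV[R]_n => phi q.1) (cst 0)).
    by apply: c1; exact: cutoff_continuous.
  exact: cvg_cst.
apply: continuousD; first exact: (c2 _ (@dot_continuous R n p.2)).
have cJ b : {for p, continuous (fun q : 'rV[R]_n * 'rV[R]_n =>
    (q.2 *m jac u q.1) ord0 b)}.
  rewrite (_ : (fun q => _) = (fun q : 'rV[R]_n * 'rV[R]_n =>
      \sum_i q.2 ord0 i * partial i (component u b) q.1)); last first.
    by apply/funext => q; rewrite mxE; apply: eq_bigr => i _; rewrite mxE.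
  apply: (@cvg_bigsum _ _ _ _ _ (nbhs p)) => i _.
  have ce := c2 (fun v => v ord0 i) (@coord_continuous _ _ _ ord0 i p.2).
  exact: (continuousM ce (c1 _ (smooth_continuous (smooth_partial i (su b)) Dp))).
by apply: (@cvg_bigsum _ _ _ _ _ (nbhs p)) => b _; exact: (continuousM (cJ b) (cJ b)).
Qed.

End CutoffEnergy.

(** * The interior gradient bound *)

Section GradientEstimate.
Context {R : realType} {n m : nat}.
Local Notation D := (unit_ball R n).
Context {u : 'rV[R]_n -> 'rV[R]_m} (su : forall b, smooth_on D (component u b)).
Context (b0 : 'I_m) {a c d : R} (N : nat).
Context (a0 : 0 < a) (c_def : c = 4 * n%:R + 4).
Context (cd : c * d <= 1 / 8) (d_small : 64 * c ^+ 2 * n%:R * d <= a ^+ 2).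
Context (N_large : 64 * n%:R < N%:R * a ^+ 2).
Context (mss : minimal_surface_system D u) (ad : area_decreasing D u).
Context (u_ge0 : forall x, D x -> 0 <= component u b0 x).
Context (u_small : forall x, D x ->
  \sum_(b | b != b0) component u b x ^+ 2 <= d).
Context (u_center : a * component u b0 0 <= 1 / 2).
Local Notation phi := (cutoff u b0 a c).
Local Notation F := (cutoff_energy b0 a c N.+2 (u := u)).

Let c0 : 0 < c.
Proof. by rewrite c_def; have := ler0n R n; lra. Qed.

Let phi_le x : D x -> phi x <= 7 / 8 - dot x x.
Proof.
move=> Dx; rewrite /cutoff.
have H1 : 0 <= a * component u b0 x by rewrite mulr_ge0 ?u_ge0 // ltW.
have H2 : c * \sum_(b | b != b0) component u b x ^+ 2 <= c * d.
  by rewrite ler_pM2l // u_small.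
move: (dot x x) (a * _) (c * \sum_(b | _) _) H1 H2 => p q r H1 H2; move: cd; lra.
Qed.

Let D0 : D 0. Proof. by apply/unit_ballE; rewrite dot0l. Qed.

Let phi_center : 1 / 4 <= phi 0.
Proof.
rewrite /cutoff dot0l.
have H : 0 <= c * \sum_(b | b != b0) component u b 0 ^+ 2.
  by apply: mulr_ge0; [exact: ltW|apply: sumr_ge0 => b _; exact: sqr_ge0].
move: u_center H; move: (a * _) (c * _) => p q; lra.
Qed.

(** Compactness gives a maximum over [dot x x <= 7 / 8] and unit vectors [e]; the
    cutoff is not positive on the rest of the unit ball, and homogeneity in the
    second variable removes the normalisation. *)
Lemma cutoff_energy_max : (0 < n)%N -> exists x e : 'rV[R]_n,
  [/\ D x, dot e e = 1, 0 < phi x &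
    forall y z, D y -> 0 < phi y ->
      phi y ^+ N.+2 * (dot z z + dot (z *m jac u y) (z *m jac u y)) <=
      phi x ^+ N.+2 * (1 + dot (e *m jac u x) (e *m jac u x)) * dot z z].
Proof.
move=> n0.
pose K := [set x : 'rV[R]_n | dot x x <= 7 / 8] `*` [set e : 'rV[R]_n | dot e e = 1].
have KD p : K p -> D p.1 by move=> [p1 _]; apply/unit_ballE; apply: le_lt_trans p1 _; lra.
have Kc : compact K.
  apply: compact_setX; [exact: dot_ball_compact|exact: dot_sphere_compact].
pose i0 := Ordinal n0.
have K0 : K (0, delta_mx ord0 i0).
  split => /=; first by rewrite dot0l; lra.
  by rewrite dot_delta mxE !eqxx.
have Fc : {within K, continuous F}.
  apply: continuous_in_subspaceT => p; rewrite inE => Kp.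
  exact: cutoff_energy_continuous su b0 a c N.+2 p (KD p Kp).
have [[x e]] := compact_EVT_max (ex_intro _ _ K0) Kc Fc.
rewrite inE => -[/= x78 e1] Fmax.
have Dx : D x by apply/unit_ballE; apply: le_lt_trans x78 _; lra.
have E1 y z : dot y y <= 7 / 8 -> dot z z = 1 -> F (y, z) <= F (x, e).
  by move=> y78 z1; apply: Fmax; rewrite inE.
have FE y z : 0 < phi y -> F (y, z) =
    phi y ^+ N.+2 * (dot z z + dot (z *m jac u y) (z *m jac u y)).
  by move=> p0; rewrite /cutoff_energy /= max_l // ltW.
have phix : 0 < phi x.
  rewrite ltNge; apply/negP => p0.
  have Fx0 : F (x, e) = 0 by rewrite /cutoff_energy /= max_r // expr0n /= mul0r.
  have q0 : 0 < phi 0 by apply: lt_le_trans phi_center; lra.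
  have := E1 0 _ K0.1 K0.2; rewrite FE // Fx0 leNgt => /negP; apply.
  by rewrite mulr_gt0 ?exprn_gt0 // [X in X + _]K0.2 ltr_wpDr // dot_ge0.
exists x, e; split=> // y z Dy py.
have y78 : dot y y <= 7 / 8 by have := phi_le y Dy; move: (phi y) py => p; lra.
have [z0|z0] := eqVneq (dot z z) 0.
  by rewrite (dot_eq0 z0) mul0mx !dot0l addr0 !mulr0.
have zp : 0 < dot z z by rewrite lt_neqAle eq_sym z0 dot_ge0.
pose s := Num.sqrt (dot z z).
have s0 : s != 0 by rewrite gt_eqF // sqrtr_gt0.
have s2 : dot z z = s ^+ 2 by rewrite sqr_sqrtr // ltW.
have := E1 y (s^-1 *: z) y78; rewrite !FE // -scalemxAl !dotE e1 s2.
have -> : s^-1 * (s^-1 * s ^+ 2) = 1 by field.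
move=> /(_ erefl).
set G := dot (z *m _) _; set P := phi y ^+ _; set Q := _ * (1 + _).
have -> : P * (1 + s^-1 * (s^-1 * G)) = P * (s ^+ 2 + G) / s ^+ 2 by field.
by rewrite ler_pdivrMr // -s2.
Qed.

(** At the maximum point either the largest singular value is bounded, and then
    the maximal value bounds the gradient at the origin, or it is large, which
    [max_point_inequality] and [large_gradient_absurd] exclude. *)
Lemma interior_gradient_bound (z : 'rV[R]_n) : (0 < n)%N -> dot z z = 1 ->
  dot (z *m jac u 0) (z *m jac u 0) <= 4 ^+ N.+2 * (4 + (32 / a) ^+ 2).
Proof.
move=> n0 z1; have [x [e [Dx e1 px xmax]]] := cutoff_energy_max n0.
have [Llarge|Lsmall] := lerP (3 + (32 / a) ^+ 2) (dot (e *m jac u x) (e *m jac u x)).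
  exfalso.
  have oD : open D := unit_ball_open.
  have L0 : 0 < dot (e *m jac u x) (e *m jac u x).
    by apply: lt_le_trans Llarge; have := sqr_ge0 (32 / a); lra.
  have Jf v := has_jet_cutoff oD u su b0 a c v Dx.
  have emax v w : \forall t \near (0 : R),
     phi (t *: v + x) ^+ N.+2 * (dot (e + t *: w) (e + t *: w) +
      dot ((e + t *: w) *m jac u (t *: v + x)) ((e + t *: w) *m jac u (t *: v + x)))
    <= phi x ^+ N.+2 * (1 + dot (e *m jac u x) (e *m jac u x)) *
        dot (e + t *: w) (e + t *: w).
    have Np : \forall y \near x, 0 < phi y.
      have /cvgrPdist_lt /(_ _ px) := cutoff_continuous su b0 a c Dx.
      by apply: filterS => y; rewrite ltr_distlC => /andP[+ _]; rewrite subrr.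
    have ND : \forall y \near x, D y by apply: open_nbhs_nbhs.
    by apply: filterS2 (near_line v ND) (near_line v Np) => t; exact: xmax.
  have eig := max_point_eigen oD su Dx N px (cutoff10 u b0 a c x) Jf e1 emax.
  have area := area_decreasing_dot oD su ad Dx e1 eig.
  have := max_point_inequality oD su Dx N px (cutoff10 u b0 a c x) Jf e1 emax L0 area mss.
  rewrite leNgt => /negP; apply.
  have x1 : dot x x <= 1 by apply/ltW/unit_ballE.
  apply: (large_gradient_absurd oD su mss b0 a0 c_def Dx x1 (u_small x Dx) d_small
    e1 eig area Llarge) => //.
  by have := phi_le x Dx; have := dot_ge0 x; move: (phi x) => p; lra.
have p0 : 0 < phi 0 by apply: lt_le_trans phi_center; lra.
have := xmax 0 z D0 p0; rewrite z1 mulr1.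
set G := dot (z *m _) _; move: Lsmall; set L := dot (e *m _) _ => Lsmall H.
have L0 : 0 <= L by exact: dot_ge0.
have G0 : 0 <= G by exact: dot_ge0.
have px1 : phi x <= 1.
  by have := phi_le x Dx; have := dot_ge0 x; move: (phi x) => p; lra.
have H1 : (1 / 4) ^+ N.+2 * (1 + G) <= phi 0 ^+ N.+2 * (1 + G).
  by rewrite ler_wpM2r ?addr_ge0 // lerXn2r ?nnegrE // ltW.
have H2 : phi x ^+ N.+2 * (1 + L) <= 1 + L.
  by rewrite ler_piMl ?addr_ge0 // exprn_ile1 // ltW.
have H3 : (1 / 4) ^+ N.+2 * (1 + G) <= 1 + L by apply: le_trans H2; apply: le_trans H.
have -> : G = 4 ^+ N.+2 * ((1 / 4) ^+ N.+2 * G).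
  by rewrite mulrA -exprMn mulrCA divff ?mulr1 ?expr1n ?mul1r.
rewrite ler_pM2l ?exprn_gt0 //.
have : 0 <= (1 / 4 : R) ^+ N.+2 by rewrite exprn_ge0 // divr_ge0.
move: H3; rewrite mulrDr mulr1; move: ((1 / 4 : R) ^+ N.+2) (_ * G) => p q.
move: Lsmall; move: ((32 / a) ^+ 2) => r; lra.
Qed.

End GradientEstimate.

Theorem proposition6p3 (R : realType) (n m : nat)
    (hn : (0 < n)%N) (hm : (0 < m)%N) :
  exists C2 : R, 0 < C2 /\
  forall M : R,
  exists C1 eps0 : R, [/\ 0 < C1, 0 < eps0 &
  forall u : 'rV[R]_n -> 'rV[R]_m,
    (forall b : 'I_m, smooth_on (unit_ball R n) (component u b)) ->
    minimal_surface_system (unit_ball R n) u ->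
    area_decreasing (unit_ball R n) u ->
    Linfty_norm (unit_ball R n) (fun x => enorm (u x)) = M%:E ->
    (forall b : 'I_m, b = 0%N :> nat ->
       forall x, unit_ball R n x -> 0 <= component u b x) ->
    forall eps : R,
    (forall b : 'I_m, (0 < b)%N ->
       (Linfty_norm (unit_ball R n) (component u b) < eps%:E)%E) ->
    eps <= eps0 ->
    enorm ('J u 0) <= C1 * expR (C2 * M ^+ 2)].
Proof.
exists 1; split=> // M.
pose b0 := Ordinal hm.
pose a : R := (2 * (`|M| + 1))^-1.
(* [a] is small enough for [a * u^1 (0) <= 1 / 2].  With [c > 4 n] the quadratic
   term of the cutoff outweighs the Laplacian of [- |x|^2], which is at least
   [- 2 n].  The bound [d] on the sum of the squares of the small components
   keeps that term below [1 / 8] and its gradient below [a / 4]. *)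
pose c : R := 4 * n%:R + 4.
pose d : R := Num.min (1 / (8 * c)) (a ^+ 2 / (64 * c ^+ 2 * n%:R)).
pose N := Num.bound (64 * n%:R / a ^+ 2).
pose B : R := 4 ^+ N.+2 * (4 + (32 / a) ^+ 2).
have n0 : 0 < n%:R :> R by rewrite ltr0n.
have m0 : 0 < m%:R :> R by rewrite ltr0n.
have M1 : 0 < `|M| + 1 by have := normr_ge0 M; lra.
have a0 : 0 < a by rewrite invr_gt0 mulr_gt0.
have c0 : 0 < c by rewrite /c; lra.
have a20 : 0 < a ^+ 2 by rewrite exprn_gt0.
have k0 : 0 < 64 * c ^+ 2 * n%:R by rewrite !mulr_gt0 // exprn_gt0.
have d0 : 0 < d by rewrite lt_min !divr_gt0 // mulr_gt0.
have cd : c * d <= 1 / 8.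
  apply: le_trans (_ : c * (1 / (8 * c)) <= _).
    by rewrite ler_pM2l // ge_min lexx.
  by rewrite le_eqVlt; apply/orP; left; apply/eqP; field; rewrite gt_eqF.
have d_small : 64 * c ^+ 2 * n%:R * d <= a ^+ 2.
  by rewrite mulrC -ler_pdivlMr // ge_min lexx orbT.
have N_large : 64 * n%:R < N%:R * a ^+ 2.
  by rewrite -ltr_pdivrMr // archi_boundP // divr_ge0 ?mulr_ge0 // ltW.
have B0 : 0 <= B by rewrite mulr_ge0 ?exprn_ge0 // addr_ge0 // sqr_ge0.
exists (Num.sqrt (n%:R * B) + 1), (Num.sqrt (d / m%:R)); split.
- by have := sqrtr_ge0 (n%:R * B); lra.
- by rewrite sqrtr_gt0 divr_gt0.
move=> u su mss ad uM u0 eps u_eps eps_le.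
have oD : open (unit_ball R n) := unit_ball_open.
have D0 : unit_ball R n 0 by apply/unit_ballE; rewrite dot0l.
have u_ge0 x : unit_ball R n x -> 0 <= component u b0 x by exact: u0.
have u_small x : unit_ball R n x ->
    \sum_(b | b != b0) component u b x ^+ 2 <= d.
  move=> Dx; have ub b : b != b0 -> component u b x ^+ 2 <= d / m%:R.
    move=> bb0; have b_gt0 : (0 < b)%N.
      by rewrite lt0n; apply: contra bb0 => /eqP b00; apply/eqP/val_inj.
    have := Linfty_norm_pointwise _ oD Dx (smooth_continuous (su b) Dx)
      (ltW (u_eps b b_gt0)).
    move=> /le_trans /(_ eps_le) H.
    have <- : Num.sqrt (d / m%:R) ^+ 2 = d / m%:R.
      by rewrite sqr_sqrtr // divr_ge0 // ltW.
    rewrite -(real_normK (num_real (component u b x))).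
    by rewrite lerXn2r ?nnegrE ?sqrtr_ge0.
  apply: le_trans (ler_sum _ ub) _.
  apply: le_trans (_ : \sum_(b < m) d / m%:R <= _).
    rewrite [leRHS](bigID (fun b => b != b0)) /= lerDl.
    by apply: sumr_ge0 => b _; rewrite divr_ge0 ?ltW.
  by rewrite sumr_const card_ord -[_ *+ m]mulr_natr divfK // gt_eqF.
have u_center : a * component u b0 0 <= 1 / 2.
  have cu : {for 0, continuous (fun x => enorm (u x))}.
    have dotu : {for 0, continuous (fun x => dot (u x) (u x))}.
      apply: (@cvg_bigsum _ _ _ _ _ (nbhs (0 : 'rV[R]_n))) => b _.
      have cb := smooth_continuous (su b) D0; exact: (continuousM cb cb).
    rewrite (_ : (fun x => enorm (u x)) = Num.sqrt \o (fun x => dot (u x) (u x))).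
      by apply: continuous_comp dotu _; exact: sqrt_continuous.
    by apply/funext => x; rewrite enorm_rV.
  have := Linfty_norm_pointwise M oD D0 cu; rewrite uM lexx => /(_ isT) uM0.
  have ule : component u b0 0 <= `|M| + 1.
    apply: le_trans (ler_norm _) _; rewrite -sqrtr_sqr.
    apply: le_trans (_ : enorm (u 0) <= _).
      by rewrite enorm_rV ler_wsqrtr // coord_sqr_le_dot.
    apply: le_trans (ler_norm _) _; apply: le_trans uM0 _.
    by apply: le_trans (ler_norm _) _; rewrite lerDl.
  rewrite /a mulrC ler_pdivrMr ?mulr_gt0 //; lra.
have bound i : dot (row i (jac u 0)) (row i (jac u 0)) <= B.
  rewrite rowE; apply: (interior_gradient_bound su b0 N a0 erefl cd d_small
    N_large mss ad u_ge0 u_small u_center) => //.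
  by rewrite dot_delta mxE !eqxx.
apply: le_trans (_ : Num.sqrt (n%:R * B) <= _).
  rewrite /enorm (jacobianE oD su D0) ler_wsqrtr //.
  apply: le_trans (_ : \sum_(i < n) B <= _).
    apply: ler_sum => i _; apply: le_trans (bound i).
    rewrite le_eqVlt; apply/orP; left; apply/eqP; apply: eq_bigr => b _.
    by rewrite [row i _ ord0 b]mxE expr2.
  by rewrite sumr_const card_ord mulr_natl.
have E1 : 1 <= expR (1 * M ^+ 2).
  by apply: le_trans (expR_ge1Dx _); rewrite mul1r lerDl sqr_ge0.
have := sqrtr_ge0 (n%:R * B); move: (Num.sqrt _) E1 => r E1 r0.
by rewrite -[leLHS]mulr1 ler_pM // lerDl.
Qed.
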